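(* Assume $( * )$, i.e. work in ZF + DC + ''every subset of $2^{\omega}$ has the Baire property''. If $X$ is a topological space that is first countable at a point $x\in X$ and each neighborhood of $x$ contains an essential loop at $x$, then $|2^{\omega}|\leq|\pi_1(X,x)|$.
   Context: $( * )$ denotes the theory ZF + DC + ''every subset of the Cantor space $2^{\omega}=\{0,1\}^{\omega}$ (product topology) has the Baire property''; the full axiom of choice is not assumed. DC is the axiom of dependent choice: if $R$ is a binary relation on a nonempty set $X$ with $(\forall x)(\exists y)(xRy)$, then there is a sequence $(z_n)_{n\in\omega}$ with $z_nRz_{n+1}$ for all $n$. A subset $Y$ of a space $X$ has the Baire property if there is an open $U\subseteq X$ such that $Y\Delta U$ is meager in $X$. For sets $X,Y$, $|X|\leq|Y|$ means that there is an injection from $X$ to $Y$. A loop at $x$ is essential if its class in $\pi_1(X,x)$ is nontrivial. *)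

(* Defs.v *)
(* The theorem is a theorem of the choiceless theory ZF + DC + "every subset of
   the Cantor space has the Baire property".  The ambient logic may have a
   choice operator, which would refute the last axiom for subsets of
   nat -> bool, so Rocq types do not serve as sets here.  A set is an element of
   an arbitrary model M of first-order ZF, and all mathematical notions below
   are interpreted inside M: sequences are elements of M indexed by the omega of
   M, subsets are elements of M, and so on.  By the completeness theorem, truth
   in all models of the theory is the same as provability from it. *)

Set Implicit Arguments.
Unset Strict Implicit.
Unset Printing Implicit Defensive.

Record structure := Structure {
  carrier :> Type;
  mem : carrier -> carrier -> Prop
}.

Arguments mem {s}.
Notation "x ∈ y" := (mem x y) (at level 70, no associativity).

(* First-order formulas of the language of set theory, with de Bruijn indices. *)

Inductive formula : Type :=
| FMem (i j : nat)
| FEq (i j : nat)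
| FNot (p : formula)
| FAnd (p q : formula)
| FOr (p q : formula)
| FImp (p q : formula)
| FAll (p : formula)
| FEx (p : formula).

Definition scons (T : Type) (a : T) (e : nat -> T) (n : nat) : T :=
  match n with O => a | S k => e k end.

Fixpoint sat (M : structure) (p : formula) (e : nat -> M) : Prop :=
  match p with
  | FMem i j => e i ∈ e j
  | FEq i j => e i = e j
  | FNot p => ~ sat p e
  | FAnd p q => sat p e /\ sat q e
  | FOr p q => sat p e \/ sat q e
  | FImp p q => sat p e -> sat q e
  | FAll p => forall a : M, sat p (scons a e)
  | FEx p => exists a : M, sat p (scons a e)
  end.

Definition subset (M : structure) (a b : M) : Prop :=
  forall z, z ∈ a -> z ∈ b.
Notation "a ⊆ b" := (subset a b) (at level 70, no associativity).

Definition is_empty (M : structure) (a : M) : Prop := forall z, ~ z ∈ a.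

Definition is_upair (M : structure) (c a b : M) : Prop :=
  forall z, z ∈ c <-> z = a \/ z = b.

Definition is_union (M : structure) (u a : M) : Prop :=
  forall z, z ∈ u <-> exists y, y ∈ a /\ z ∈ y.

Definition is_power (M : structure) (p a : M) : Prop :=
  forall z, z ∈ p <-> z ⊆ a.

Definition is_inter (M : structure) (c a b : M) : Prop :=
  forall z, z ∈ c <-> z ∈ a /\ z ∈ b.

Definition is_symdiff (M : structure) (c a b : M) : Prop :=
  forall z, z ∈ c <-> (z ∈ a /\ ~ z ∈ b) \/ (z ∈ b /\ ~ z ∈ a).

(* s = n ∪ {n} *)
Definition is_succ (M : structure) (s n : M) : Prop :=
  forall z, z ∈ s <-> z ∈ n \/ z = n.

Definition inductive (M : structure) (w : M) : Prop :=
  (exists e, is_empty e /\ e ∈ w) /\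
  (forall n, n ∈ w -> exists s, is_succ s n /\ s ∈ w).

Record ZF (M : structure) : Prop := {
  zf_extensionality :
    forall a b : M, (forall z, z ∈ a <-> z ∈ b) -> a = b;
  zf_foundation :
    forall a : M, (exists z, z ∈ a) ->
      exists z, z ∈ a /\ ~ exists y, y ∈ z /\ y ∈ a;
  zf_pairing : forall a b : M, exists c, is_upair c a b;
  zf_union : forall a : M, exists u, is_union u a;
  zf_power : forall a : M, exists p, is_power p a;
  zf_infinity : exists w : M, inductive w;
  zf_separation :
    forall (p : formula) (e : nat -> M) (a : M),
      exists b, forall z, z ∈ b <-> z ∈ a /\ sat p (scons z e);
  zf_replacement :
    forall (p : formula) (e : nat -> M) (a : M),
      (forall x y y', x ∈ a ->
         sat p (scons x (scons y e)) -> sat p (scons x (scons y' e)) ->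
         y = y') ->
      exists b, forall y,
        y ∈ b <-> exists x, x ∈ a /\ sat p (scons x (scons y e))
}.

(* Kuratowski pairs; relations and functions are sets of pairs. *)

Definition is_opair (M : structure) (p a b : M) : Prop :=
  exists u v, is_upair u a a /\ is_upair v a b /\ is_upair p u v.

Definition is_prod (M : structure) (c A B : M) : Prop :=
  forall p, p ∈ c <-> exists a b, a ∈ A /\ b ∈ B /\ is_opair p a b.

(* (a, b) ∈ r; for a function r, this says r(a) = b. *)
Definition rel (M : structure) (r a b : M) : Prop :=
  exists p, is_opair p a b /\ p ∈ r.

(* ((a, b), c) ∈ f, that is, f(a, b) = c for a function f on a product. *)
Definition rel2 (M : structure) (f a b c : M) : Prop :=
  exists p, is_opair p a b /\ rel f p c.

Definition is_fun (M : structure) (f A B : M) : Prop :=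
  (forall p, p ∈ f -> exists a b, a ∈ A /\ b ∈ B /\ is_opair p a b) /\
  (forall a, a ∈ A -> exists! b, rel f a b).

Definition is_expo (M : structure) (F A B : M) : Prop :=
  forall f, f ∈ F <-> is_fun f A B.

(* |A| ≤ |B| *)
Definition card_le (M : structure) (A B : M) : Prop :=
  exists f, is_fun f A B /\
    forall a a' b, rel f a b -> rel f a' b -> a = a'.

Definition is_omega (M : structure) (w : M) : Prop :=
  inductive w /\ forall v, inductive v -> w ⊆ v.

Definition is_two (M : structure) (t : M) : Prop :=
  exists o i, is_empty o /\ is_succ i o /\ is_upair t o i.

Definition topology (M : structure) (X T : M) : Prop :=
  (forall U, U ∈ T -> U ⊆ X) /\
  (forall e, is_empty e -> e ∈ T) /\
  X ∈ T /\
  (forall F U, F ⊆ T -> is_union U F -> U ∈ T) /\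
  (forall U V W, U ∈ T -> V ∈ T -> is_inter W U V -> W ∈ T).

(* T is the coarsest topology on X in which all sets satisfying S are open. *)
Definition generated_topology (M : structure) (X : M) (S : M -> Prop) (T : M)
    : Prop :=
  topology X T /\ (forall U, S U -> U ∈ T) /\
  forall T', topology X T' -> (forall U, S U -> U ∈ T') -> T ⊆ T'.

Definition is_preimage (M : structure) (W f A V : M) : Prop :=
  forall a, a ∈ W <-> a ∈ A /\ exists b, rel f a b /\ b ∈ V.

Definition continuous (M : structure) (A TA B TB f : M) : Prop :=
  is_fun f A B /\
  forall V W, V ∈ TB -> is_preimage W f A V -> W ∈ TA.

Definition neighborhood (M : structure) (X T x N : M) : Prop :=
  N ⊆ X /\ exists U, U ∈ T /\ x ∈ U /\ U ⊆ N.

(* Product topology on C = 2^omega, where {0,1} is discrete. *)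
Definition is_cantor_topology (M : structure) (w two C T : M) : Prop :=
  generated_topology C
    (fun S => exists n B, n ∈ w /\ B ⊆ two /\
       forall f, f ∈ S <-> f ∈ C /\ exists i, rel f n i /\ i ∈ B) T.

Definition is_product_topology (M : structure) (A TA B TB Q T : M) : Prop :=
  is_prod Q A B /\
  generated_topology Q
    (fun S => (exists U, U ∈ TA /\ is_prod S U B) \/
              (exists V, V ∈ TB /\ is_prod S A V)) T.

(* (R, add, mul, zero, one, lt) is a complete ordered field; this determines
   it up to isomorphism inside M. *)
Record is_reals (M : structure) (R add mul zero one lt : M) : Prop := {
  add_fun : exists Q, is_prod Q R R /\ is_fun add Q R;
  mul_fun : exists Q, is_prod Q R R /\ is_fun mul Q R;
  zero_in : zero ∈ R;
  one_in : one ∈ R;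
  lt_rel : forall p, p ∈ lt -> exists a b, a ∈ R /\ b ∈ R /\ is_opair p a b;
  addA : forall a b c ab bc s, rel2 add a b ab -> rel2 add b c bc ->
    rel2 add ab c s -> rel2 add a bc s;
  addC : forall a b c, rel2 add a b c -> rel2 add b a c;
  add0 : forall a, a ∈ R -> rel2 add zero a a;
  addN : forall a, a ∈ R -> exists b, b ∈ R /\ rel2 add a b zero;
  mulA : forall a b c ab bc s, rel2 mul a b ab -> rel2 mul b c bc ->
    rel2 mul ab c s -> rel2 mul a bc s;
  mulC : forall a b c, rel2 mul a b c -> rel2 mul b a c;
  mul1 : forall a, a ∈ R -> rel2 mul one a a;
  mulV : forall a, a ∈ R -> a <> zero -> exists b, b ∈ R /\ rel2 mul a b one;
  distr : forall a b c bc ab ac s, rel2 add b c bc ->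
    rel2 mul a b ab -> rel2 mul a c ac -> rel2 mul a bc s -> rel2 add ab ac s;
  one_neq_zero : one <> zero;
  lt_irr : forall a, ~ rel lt a a;
  lt_trans : forall a b c, rel lt a b -> rel lt b c -> rel lt a c;
  lt_total : forall a b, a ∈ R -> b ∈ R -> rel lt a b \/ a = b \/ rel lt b a;
  lt_add : forall a b c ac bc, rel lt a b ->
    rel2 add a c ac -> rel2 add b c bc -> rel lt ac bc;
  lt_mul : forall a b ab, rel lt zero a -> rel lt zero b ->
    rel2 mul a b ab -> rel lt zero ab;
  lt_complete : forall S, S ⊆ R -> (exists a, a ∈ S) ->
    (exists u, u ∈ R /\ forall a, a ∈ S -> rel lt a u \/ a = u) ->
    exists l, l ∈ R /\ (forall a, a ∈ S -> rel lt a l \/ a = l) /\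
      forall u, u ∈ R -> (forall a, a ∈ S -> rel lt a u \/ a = u) ->
        rel lt l u \/ l = u
}.

Definition is_unit_interval (M : structure) (R zero one lt I : M) : Prop :=
  forall t, t ∈ I <->
    t ∈ R /\ (rel lt zero t \/ zero = t) /\ (rel lt t one \/ t = one).

(* Topology on I ⊆ R induced by the topology of R. *)
Definition is_interval_topology (M : structure) (R lt I T : M) : Prop :=
  forall U, U ∈ T <->
    U ⊆ I /\
    forall t, t ∈ U -> exists a b, a ∈ R /\ b ∈ R /\ rel lt a t /\ rel lt t b /\
      forall s, s ∈ I -> rel lt a s -> rel lt s b -> s ∈ U.

(* The sets omega, 2^omega, the real line, [0,1] and [0,1] × [0,1] of M. *)
Record standard_sets (M : structure) := StandardSets {
  omega : M;
  omegaP : is_omega omega;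
  two : M;
  twoP : is_two two;
  cantor : M;
  cantorP : is_expo cantor omega two;
  cantor_top : M;
  cantor_topP : is_cantor_topology omega two cantor cantor_top;
  reals : M;
  radd : M;
  rmul : M;
  rzero : M;
  rone : M;
  rlt : M;
  realsP : is_reals reals radd rmul rzero rone rlt;
  itv : M;
  itvP : is_unit_interval reals rzero rone rlt itv;
  itv_top : M;
  itv_topP : is_interval_topology reals rlt itv itv_top;
  square : M;
  square_top : M;
  square_topP : is_product_topology itv itv_top itv itv_top square square_top
}.

Definition DC (M : structure) (S : standard_sets M) : Prop :=
  forall X R P : M, (exists x, x ∈ X) -> is_prod P X X -> R ⊆ P ->
    (forall x, x ∈ X -> exists y, y ∈ X /\ rel R x y) ->
    exists z, is_fun z (omega S) X /\
      forall n m a b, n ∈ omega S -> is_succ m n ->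
        rel z n a -> rel z m b -> rel R a b.

Definition countable (M : structure) (S : standard_sets M) (A : M) : Prop :=
  card_le A (omega S).

Definition in_closure (M : structure) (X T A z : M) : Prop :=
  z ∈ X /\ forall U, U ∈ T -> z ∈ U -> exists a, a ∈ U /\ a ∈ A.

(* The closure of A has empty interior. *)
Definition nowhere_dense (M : structure) (X T A : M) : Prop :=
  A ⊆ X /\
  ~ exists U, U ∈ T /\ (exists z, z ∈ U) /\
      forall z, z ∈ U -> in_closure X T A z.

Definition meager (M : structure) (S : standard_sets M) (X T A : M) : Prop :=
  exists F, countable S F /\ (forall N, N ∈ F -> nowhere_dense X T N) /\
    is_union A F.

Definition baire_property (M : structure) (S : standard_sets M) (X T Y : M)
    : Prop :=
  exists U D, U ∈ T /\ is_symdiff D Y U /\ meager S X T D.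

Definition all_baire_property (M : structure) (S : standard_sets M) : Prop :=
  forall Y : M, Y ⊆ cantor S -> baire_property S (cantor S) (cantor_top S) Y.

Definition first_countable_at (M : structure) (S : standard_sets M) (X T x : M)
    : Prop :=
  exists B, countable S B /\ (forall N, N ∈ B -> neighborhood X T x N) /\
    forall N, neighborhood X T x N -> exists N', N' ∈ B /\ N' ⊆ N.

Definition loop (M : structure) (S : standard_sets M) (X T x f : M) : Prop :=
  continuous (itv S) (itv_top S) X T f /\
  rel f (rzero S) x /\ rel f (rone S) x.

(* Homotopy relative to the endpoints, for loops f and g at x. *)
Definition homotopic (M : structure) (S : standard_sets M) (X T x f g : M)
    : Prop :=
  exists H, continuous (square S) (square_top S) X T H /\
    (forall t y, t ∈ itv S -> rel f t y -> rel2 H t (rzero S) y) /\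
    (forall t y, t ∈ itv S -> rel g t y -> rel2 H t (rone S) y) /\
    (forall s, s ∈ itv S -> rel2 H (rzero S) s x /\ rel2 H (rone S) s x).

(* c is the homotopy class of the loop f *)
Definition is_class (M : structure) (S : standard_sets M) (X T x c f : M)
    : Prop :=
  forall g, g ∈ c <-> loop S X T x g /\ homotopic S X T x f g.

(* The underlying set of the fundamental group: the homotopy classes of loops
   at x.  Its neutral element is the class of the constant loop. *)
Definition is_pi1 (M : structure) (S : standard_sets M) (X T x P : M) : Prop :=
  forall c, c ∈ P <-> exists f, loop S X T x f /\ is_class S X T x c f.

Definition is_constant_loop (M : structure) (S : standard_sets M) (X x k : M)
    : Prop :=
  is_fun k (itv S) X /\ forall t, t ∈ itv S -> rel k t x.

Definition essential (M : structure) (S : standard_sets M) (X T x f : M)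
    : Prop :=
  loop S X T x f /\
  exists c d k, is_class S X T x c f /\
    is_constant_loop S X x k /\ is_class S X T x d k /\ c <> d.

(* Main.v *)
(* Every set and function below lives in M.  A type is small when it is
   identified with a set of M, and a predicate on it is definable when its
   extension is an element of M; definability is closed under the logical
   operations, so arguments can be carried out with predicates and functions of
   the metatheory.

   Let f_n be essential loops at x that shrink to x (dependent choice and first
   countability).  For a in 2^omega let F_a be the loop that traverses f_n on a
   part of ]e_n, 2 e_n[ when a(n) = 1, where e_(n+1) = e_n / 2, and stays at x
   elsewhere.  If a and b differ in a single digit n then F_a and F_b are not
   homotopic, as f_n would be nullhomotopic.  Hence the set Y of all codes of
   pairs (a, b) with F_a and F_b homotopic is disjoint from its image under any
   change of a single digit of a.  By the Baire property Y differs from an open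
   set U by a meager set.  A meager set misses all points that agree with some
   fixed z on infinitely many blocks of some partition of omega into intervals;
   so U nonempty would give two points of Y that differ in one such digit.  Thus
   Y is meager, and a map phi on 2^omega can be built blockwise from z such that
   the code of (phi a, phi b) or of (phi b, phi a) agrees with z on infinitely
   many blocks if a <> b.  Then F_(phi a) and F_(phi b) are not homotopic. *)

(* The omega of [M] may be nonstandard and the metatheory has a choice operator, so an outside
   predicate or function says nothing about [M] until its extension or graph is an element of [M].
   Induction on omega is restricted accordingly, and recursion is replaced by dependent choice. The
   blockwise map works as follows. Pairs are coded by interleaving, so each block of z has two
   halves. Fix h : omega -> omega taking every value infinitely often. On block k, phi(a) copies the
   first half of z if a(h(k)) = 1 and the second half otherwise. If a(p) = 1 and b(p) = 0, the code
   of (phi a, phi b) equals z on every block k with h(k) = p. Homotopy enters here only as a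
   symmetric transitive relation that never relates points differing in a single digit: two codes in
   Y that differ in one digit of the first component share the second, so their first components
   would be related. The single-digit statement is proved without the group structure: a homotopy
   from F_a to F_b, restricted to suitable paths in the square, is turned into a contraction of
   f_n. *)
From HB Require Import structures.
From mathcomp Require Import all_boot all_order all_algebra boolp ring lra.
Require Import Defs.
Import Order.TTheory GRing.Theory Num.Theory.

Set Implicit Arguments.
Unset Strict Implicit.
Unset Printing Implicit Defensive.

(** * Definability *)

Existing Class ZF.
Existing Class standard_sets.

Section Expressible.
Context {M : structure}.
Implicit Types (P Q : (nat -> M) -> Prop).

(** Semantic counterpart of [formula]: separation can be applied to a Rocq predicate on environments
    as soon as the [expr_] lemmas mirror its syntax, and no de Bruijn formula is written by hand. *)
Definition expressible P := exists p, forall e, sat p e <-> P e.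

Lemma expr_mem i j : expressible (fun e => e i ∈ e j).
Proof. by exists (FMem i j). Qed.

Lemma expr_eq i j : expressible (fun e => e i = e j).
Proof. by exists (FEq i j). Qed.

Lemma expr_not P : expressible P -> expressible (fun e => ~ P e).
Proof. by case=> p pP; exists (FNot p) => e /=; rewrite pP. Qed.

Lemma expr_and P Q :
  expressible P -> expressible Q -> expressible (fun e => P e /\ Q e).
Proof. by case=> p pP [q qP]; exists (FAnd p q) => e /=; rewrite pP qP. Qed.

Lemma expr_or P Q :
  expressible P -> expressible Q -> expressible (fun e => P e \/ Q e).
Proof. by case=> p pP [q qP]; exists (FOr p q) => e /=; rewrite pP qP. Qed.

Lemma expr_imp P Q :
  expressible P -> expressible Q -> expressible (fun e => P e -> Q e).
Proof. by case=> p pP [q qP]; exists (FImp p q) => e /=; rewrite pP qP. Qed.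

Lemma expr_iff P Q :
  expressible P -> expressible Q -> expressible (fun e => P e <-> Q e).
Proof. by move=> eP eQ; apply: expr_and; apply: expr_imp. Qed.

Lemma expr_all (P : M -> (nat -> M) -> Prop) :
  expressible (fun e => P (e 0) (fun n => e n.+1)) ->
  expressible (fun e => forall a, P a e).
Proof.
case=> p pP; exists (FAll p) => e /=.
by split=> H a; have := H a; rewrite pP.
Qed.

Lemma expr_ex (P : M -> (nat -> M) -> Prop) :
  expressible (fun e => P (e 0) (fun n => e n.+1)) ->
  expressible (fun e => exists a, P a e).
Proof.
case=> p pP; exists (FEx p) => e /=.
by split=> -[a Ha]; exists a; move: Ha; rewrite pP.
Qed.

End Expressible.

Ltac express :=
  rewrite /is_fun /rel2 /rel /is_opair /is_upair /subset /unique;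
  repeat first [ apply: expr_mem | apply: expr_eq | apply: expr_and
               | apply: expr_or | apply: expr_iff | apply: expr_not
               | apply: expr_imp | apply: expr_ex | apply: expr_all ].

(** * Pairs, products and function sets in a model of ZF *)

Section Sets.
Context {M : structure} {zf : ZF M}.

Lemma ext (a b : M) : (forall z, z ∈ a <-> z ∈ b) -> a = b.
Proof. exact: (zf_extensionality zf). Qed.

Lemma separation (P : (nat -> M) -> Prop) (e : nat -> M) (a : M) :
  expressible P -> exists b, forall z, z ∈ b <-> z ∈ a /\ P (scons z e).
Proof.
case=> p pP; case: (zf_separation zf p e a) => b Hb.
by exists b => z; rewrite Hb pP.
Qed.

Lemma upair_inj (c a b a' b' : M) : is_upair c a b -> is_upair c a' b' ->
  (a = a' /\ b = b') \/ (a = b' /\ b = a').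
Proof.
move=> H H'.
have Ha : a = a' \/ a = b' by apply/H'/H; left.
have Hb : b = a' \/ b = b' by apply/H'/H; right.
have Ha' : a' = a \/ a' = b by apply/H/H'; left.
have Hb' : b' = a \/ b' = b by apply/H/H'; right.
by case: Ha Hb Ha' Hb' => -> [->|->] [] ? [] ?; subst; auto.
Qed.

Lemma opair_ex (a b : M) : exists p, is_opair p a b.
Proof.
case: (zf_pairing zf a a) => u Hu; case: (zf_pairing zf a b) => v Hv.
by case: (zf_pairing zf u v) => p Hp; exists p, u, v.
Qed.

Definition opair (a b : M) : M := sval (cid (opair_ex a b)).

Lemma opairP a b : is_opair (opair a b) a b.
Proof. by rewrite /opair; case: cid. Qed.

Lemma upair_uniq (c c' a b : M) : is_upair c a b -> is_upair c' a b -> c = c'.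
Proof. by move=> H H'; apply: ext => z; rewrite H H'. Qed.

Lemma is_opairE (p a b : M) : is_opair p a b <-> p = opair a b.
Proof.
split=> [[u [v [Hu [Hv Hp]]]]|->]; last exact: opairP.
case: (opairP a b) => u' [v' [Hu' [Hv' Hp']]].
rewrite -(upair_uniq Hu Hu') -(upair_uniq Hv Hv') in Hp'.
exact: upair_uniq Hp Hp'.
Qed.

Lemma opair_inj (a b a' b' : M) : opair a b = opair a' b' -> a = a' /\ b = b'.
Proof.
move=> E; case: (opairP a b) => u [v [Hu [Hv Hp]]].
case: (opairP a' b') => u' [v' [Hu' [Hv']]]; rewrite -E => Hp'.
have aE : a = a'.
  case: (upair_inj Hp Hp') => -[Eu Ev]; subst.
    by case: (upair_inj Hu Hu') => -[].
  by case: (upair_inj Hu Hv') => -[].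
split=> //; subst a'.
have uE := upair_uniq Hu Hu'; subst u'.
have vE : v = v' by case: (upair_inj Hp Hp') => -[] // -> ->.
subst v'; case: (upair_inj Hv Hv') => -[] //.
by move=> -> ->.
Qed.

Lemma relE (r a b : M) : rel r a b <-> opair a b ∈ r.
Proof.
split=> [[p [/is_opairE -> //]]|H]; by exists (opair a b); rewrite is_opairE.
Qed.

Lemma power_ex (a : M) : exists p, is_power p a.
Proof. exact: (zf_power zf). Qed.

Definition power (a : M) : M := sval (cid (power_ex a)).

Lemma powerP a z : z ∈ power a <-> z ⊆ a.
Proof. by rewrite /power; case: cid => p /= Hp; exact: Hp. Qed.

Lemma prod_ex (a b : M) : exists c, is_prod c a b.
Proof.
case: (zf_pairing zf a b) => c Hc; case: (zf_union zf c) => u Hu.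
have [d Hd] := @separation (fun e => exists a' b',
  a' ∈ e 1 /\ b' ∈ e 2 /\ is_opair (e 0) a' b')
  (scons a (scons b (fun _ => a))) (power (power u)) ltac:(by express).
exists d => p; rewrite Hd /=; split=> [[]//|H]; split=> //.
case: H => x [y [xa [yb [v [w [Hv [Hw Hp]]]]]]].
have xu : x ∈ u by apply/Hu; exists a; split=> //; apply/Hc; left.
have yu : y ∈ u by apply/Hu; exists b; split=> //; apply/Hc; right.
apply/powerP => z /Hp [] -> {z}; apply/powerP => z.
  by move/Hv => [] ->.
by move/Hw => [] ->.
Qed.

Definition prod (a b : M) : M := sval (cid (prod_ex a b)).

Lemma prodP a b : is_prod (prod a b) a b.
Proof. by rewrite /prod; case: cid. Qed.

Lemma prodE a b p : p ∈ prod a b <-> exists x y, [/\ x ∈ a, y ∈ b & p = opair x y].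
Proof.
split=> [/prodP [x [y [xa [yb /is_opairE ->]]]]|[x [y [xa yb ->]]]].
  by exists x, y.
by apply/prodP; exists x, y; rewrite is_opairE.
Qed.

Lemma is_prodE c a b : is_prod c a b <-> c = prod a b.
Proof.
split=> [H|->]; last exact: prodP.
by apply: ext => z; rewrite H; have := prodP a b z => ->.
Qed.

Lemma expo_ex (a b : M) : exists c, is_expo c a b.
Proof.
have [d Hd] := @separation (fun e => is_fun (e 0) (e 1) (e 2))
  (scons a (scons b (fun _ => a))) (power (prod a b)) ltac:(by express).
exists d => f; rewrite Hd /=; split=> [[]//|H]; split=> //.
apply/powerP => p /(proj1 H) [x [y [xa [yb /is_opairE ->]]]].
by apply/prodE; exists x, y.
Qed.

Definition expo (a b : M) : M := sval (cid (expo_ex a b)).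

Lemma expoP a b : is_expo (expo a b) a b.
Proof. by rewrite /expo; case: cid. Qed.

End Sets.

(** * Small types and definable predicates *)

Record El (M : structure) (A : M) := MkEl { val :> M; valP : val ∈ A }.
Arguments MkEl {M A} val valP.

(** Gives a type of the metatheory a set of codes in [M]. There are instances for the elements of a
    set, products, function sets and the real numbers, so quantification over any of these preserves
    definability. *)
Class small (M : structure) (T : Type) := Small {
  emb : T -> M;
  car : M;
  emb_inj : forall x y, emb x = emb y -> x = y;
  carP : forall m, m ∈ car <-> exists x, emb x = m
}.
Arguments emb {M T _} _.
Arguments car {M} T {_}.
Arguments emb_inj {M T _ x y} _.
Arguments carP {M T _} m.

Section Small.
Context {M : structure} {zf : ZF M}.

Lemma val_inj (A : M) (x y : El A) : val x = val y -> x = y.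
Proof.
by case: x y => [x px] [y py] /= E; subst y; rewrite (Prop_irrelevance px py).
Qed.

Lemma El_carP (A m : M) : m ∈ A <-> exists x : El A, val x = m.
Proof. by split=> [mA|[x <-]]; [exists (MkEl m mA) | exact: valP]. Qed.

#[global] Instance small_El (A : M) : small M (El A) :=
  Small (@val_inj A) (El_carP A).

Section Pair.
Context {A B : Type} {sA : small M A} {sB : small M B}.

Lemma emb_pair_inj (x y : A * B) :
  opair (emb x.1) (emb x.2) = opair (emb y.1) (emb y.2) -> x = y.
Proof.
case: x y => [a b] [a' b'] /= /opair_inj [Ea Eb].
by rewrite (emb_inj Ea) (emb_inj Eb).
Qed.

Lemma pair_carP m :
  m ∈ prod (car A) (car B) <-> exists x : A * B, opair (emb x.1) (emb x.2) = m.
Proof.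
rewrite prodE; split=> [[x [y [/carP [a <-] /carP [b <-] ->]]]|[[a b] <-]].
  by exists (a, b).
by exists (emb a), (emb b); split=> //; apply/carP; [exists a|exists b].
Qed.

#[global] Instance small_pair : small M (A * B) :=
  Small emb_pair_inj pair_carP.

End Pair.

Lemma emb_car {A} {sA : small M A} (x : A) : emb x ∈ car A.
Proof. by apply/carP; exists x. Qed.

(** The set [s] later serves as a parameter of separation, so no formula for the predicate has to be
    remembered. Besides codes of [T] it may contain anything. *)
Definition definable {T} {sT : small M T} (P : T -> Prop) :=
  exists s, forall x, P x <-> emb x ∈ s.

Definition dfun {A B} {sA : small M A} {sB : small M B} (f : A -> B) :=
  definable (fun p : A * B => p.2 = f p.1).

Section Closure.
Context {A B : Type} {sA : small M A} {sB : small M B}.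

Lemma definable_sep (T : Type) (sT : small M T) (P : T -> Prop) Q (e : nat -> M) :
  expressible Q -> (forall x, P x <-> Q (scons (emb x) e)) -> definable P.
Proof.
move=> eQ PQ; have [b Hb] := separation e (car T) eQ.
exists b => x; rewrite Hb PQ; split=> [?|[]//]; split=> //; exact: emb_car.
Qed.

Lemma definable_ext (P Q : A -> Prop) :
  (forall x, P x <-> Q x) -> definable Q -> definable P.
Proof. by move=> PQ [s sP]; exists s => x; rewrite PQ. Qed.

(** Classically the extension is everything or nothing. Hence whatever does not depend on the
    variable is definable, even a fact about [M] that no formula expresses. *)
Lemma def_cst (P : Prop) : definable (fun _ : A => P).
Proof.
case: (pselect P) => HP.
  by exists (car A) => x; split=> // _; exact: emb_car.
apply: (@definable_sep _ _ _ (fun e => ~ e 0 = e 0) (fun _ => car A)).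
  by express.
by move=> x /=; split=> // /(_ erefl).
Qed.

Lemma def_not (P : A -> Prop) : definable P -> definable (fun x => ~ P x).
Proof.
case=> s sP; apply: (@definable_sep _ _ _ (fun e => ~ e 0 ∈ e 1) (fun _ => s)).
  by express.
by move=> x /=; rewrite sP.
Qed.

Lemma def_and (P Q : A -> Prop) :
  definable P -> definable Q -> definable (fun x => P x /\ Q x).
Proof.
move=> [s sP] [t tP].
apply: (@definable_sep _ _ _ (fun e => e 0 ∈ e 1 /\ e 0 ∈ e 2)
  (scons s (fun _ => t))); first by express.
by move=> x /=; rewrite sP tP.
Qed.

Lemma def_or (P Q : A -> Prop) :
  definable P -> definable Q -> definable (fun x => P x \/ Q x).
Proof.
move=> dP dQ; apply: (definable_ext (Q := fun x => ~ (~ P x /\ ~ Q x))).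
  by move=> x; rewrite -not_orP notK.
by apply: def_not; apply: def_and; apply: def_not.
Qed.

Lemma def_imp (P Q : A -> Prop) :
  definable P -> definable Q -> definable (fun x => P x -> Q x).
Proof.
move=> dP dQ; apply: (definable_ext (Q := fun x => ~ P x \/ Q x)).
  by move=> x; rewrite implyE.
by apply: def_or => //; apply: def_not.
Qed.

Lemma def_iff (P Q : A -> Prop) :
  definable P -> definable Q -> definable (fun x => P x <-> Q x).
Proof. by move=> dP dQ; apply: def_and; apply: def_imp. Qed.

Lemma def_ex (P : A -> B -> Prop) :
  definable (fun p : A * B => P p.1 p.2) -> definable (fun x => exists y, P x y).
Proof.
case=> s sP.
apply: (@definable_sep _ _ _
  (fun e => exists p y, is_opair p (e 0) y /\ (p ∈ e 1 /\ y ∈ e 2))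
  (scons s (fun _ => car B)) ltac:(by express)) => x /=; split.
  move=> [y /(sP (x, y)) H]; exists (emb (x, y)), (emb y).
  by rewrite is_opairE; do 2!split=> //; exact: emb_car.
case=> p [y [/is_opairE -> [H /carP [z Hz]]]]; subst y.
by exists z; apply/(sP (x, z)).
Qed.

End Closure.

Section Functions.
Context {A B C : Type} {sA : small M A} {sB : small M B} {sC : small M C}.

Lemma def_all (P : A -> B -> Prop) :
  definable (fun p : A * B => P p.1 p.2) -> definable (fun x => forall y, P x y).
Proof.
move=> dP; apply: (definable_ext (Q := fun x => ~ exists y, ~ P x y)).
  move=> x; split=> [H [y]|H y]; first by apply.
  by apply: contrapT => nP; apply: H; exists y.
by apply: def_not; apply: def_ex; apply: def_not.
Qed.

Lemma def_comp (P : B -> Prop) (f : A -> B) :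
  dfun f -> definable P -> definable (fun x => P (f x)).
Proof.
move=> [s sf] [t tP].
apply: (definable_ext (Q := fun x => exists y, y = f x /\ P y)).
  by move=> x; split=> [|[y [-> //]]]; exists (f x).
apply: def_ex; apply: def_and; first by exists s.
apply: (@definable_sep _ _ _
  (fun e => exists x y, is_opair (e 0) x y /\ y ∈ e 1)
  (fun _ => t) ltac:(by express)) => -[x y] /=; rewrite tP; split.
  by move=> ?; exists (emb x), (emb y); rewrite is_opairE.
by case=> x' [y' [/is_opairE /opair_inj [_ ->]]].
Qed.

Lemma dfun_id : dfun (fun x : A => x).
Proof.
apply: (@definable_sep _ _ _ (fun e => exists x, is_opair (e 0) x x)
  (fun _ => car A) ltac:(by express)) => -[x y] /=; split=> [->|].
  by exists (emb x); rewrite is_opairE.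
by case=> z /is_opairE /opair_inj [<- /emb_inj].
Qed.

Lemma dfun_compose (g : B -> C) (f : A -> B) :
  dfun f -> dfun g -> dfun (fun x => g (f x)).
Proof.
move=> [s sf] [t tg].
(* The sets [s] and [t] may contain pairs that code nothing; membership of the middle value in
   [car B] excludes those. *)
apply: (@definable_sep _ _ _ (fun e => exists x y z p q b, (is_opair (e 0) x z /\
   (is_opair p x y /\ is_opair q y z)) /\ ((p ∈ e 1 /\ q ∈ e 2) /\ (b = y /\ b ∈ e 3)))
  (scons s (scons t (fun _ => car B))) ltac:(by express)) => -[x z] /=; split.
  move=> E; exists (emb x), (emb (f x)), (emb z), (emb (x, f x)), (emb (f x, z)).
  exists (emb (f x)); rewrite !is_opairE; do !split => //; last exact: emb_car.
    exact/sf.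
  exact/tg.
case=> x' [y [z' [p [q [b [[H [Hp Hq]] [[ps qt] [E bB]]]]]]]]; subst b.
case/carP: bB => y' E; subst y.
move: H Hp Hq; rewrite !is_opairE => /opair_inj [? ?] ? ?; subst.
by move/(sf (x, y')): ps => /= <-; move/(tg (y', z)): qt.
Qed.

Lemma dfun_fst : dfun (fun p : A * B => p.1).
Proof.
apply: (@definable_sep _ _ _
  (fun e => exists x y p, is_opair (e 0) p x /\ is_opair p x y)
  (fun _ => car B) ltac:(by express)) => -[[x y] z] /=; split=> [->|].
  by exists (emb x), (emb y), (emb (x, y)); rewrite !is_opairE.
case=> x' [y' [p []]]; rewrite !is_opairE => /opair_inj [<- <-].
by move=> /opair_inj [/emb_inj].
Qed.

Lemma dfun_snd : dfun (fun p : A * B => p.2).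
Proof.
apply: (@definable_sep _ _ _
  (fun e => exists x y p, is_opair (e 0) p y /\ is_opair p x y)
  (fun _ => car B) ltac:(by express)) => -[[x y] z] /=; split=> [->|].
  by exists (emb x), (emb y), (emb (x, y)); rewrite !is_opairE.
case=> x' [y' [p []]]; rewrite !is_opairE => /opair_inj [<- <-].
by move=> /opair_inj [_ /emb_inj].
Qed.

Lemma dfun_pair (f : A -> B) (g : A -> C) :
  dfun f -> dfun g -> dfun (fun x => (f x, g x)).
Proof.
move=> [s sf] [t tg].
apply: (@definable_sep _ _ _ (fun e => exists x y z p q r, (is_opair (e 0) x r /\
   (is_opair p x y /\ (is_opair q x z /\ is_opair r y z))) /\ (p ∈ e 1 /\ q ∈ e 2))
  (scons s (fun _ => t)) ltac:(by express)) => -[x [y z]] /=; split.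
  case=> yE zE; exists (emb x), (emb y), (emb z), (emb (x, y)), (emb (x, z)).
  exists (emb (y, z)); rewrite !is_opairE; do !split => //; [exact/sf|exact/tg].
case=> x' [y' [z' [p [q [r [[+ [+ [+ +]]] [ps qt]]]]]]].
rewrite !is_opairE => /opair_inj [Ex Er] Ep Eq Er'; subst x' p q.
move: Er; rewrite Er' => /opair_inj [Ey Ez]; subst y' z'.
by move/(sf (x, y)): ps => /= ->; move/(tg (x, z)): qt => /= ->.
Qed.

Lemma dfun_cst (y : B) : dfun (fun _ : A => y).
Proof.
apply: (@definable_sep _ _ _ (fun e => exists x, is_opair (e 0) x (e 1))
  (fun _ => emb y) ltac:(by express)) => -[x z] /=; split=> [->|].
  by exists (emb x); rewrite is_opairE.
by case=> x' /is_opairE /opair_inj [_ /emb_inj].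
Qed.

Lemma def_mem_pair : definable (fun p : A * B => emb p.1 ∈ emb p.2).
Proof.
apply: (@definable_sep _ _ _ (fun e => exists x y, is_opair (e 0) x y /\ x ∈ y)
  (fun _ => car A) ltac:(by express)) => -[x z] /=; split=> [H|].
  by exists (emb x), (emb z); rewrite is_opairE.
by case=> x' [y' [/is_opairE /opair_inj [-> ->]]].
Qed.

(** For maps that change the type but not the code, such as [rval]. *)
Lemma dfun_emb (f : A -> B) : (forall x, emb (f x) = emb x) -> dfun f.
Proof.
move=> Ef; apply: (@definable_sep _ _ _ (fun e => exists x, is_opair (e 0) x x)
  (fun _ => car A) ltac:(by express)) => -[x y] /=; split=> [->|].
  by exists (emb x); rewrite is_opairE Ef.
by case=> z /is_opairE /opair_inj [<- E]; apply: emb_inj; rewrite Ef.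
Qed.

End Functions.
End Small.

Section Terms.
Context {M : structure} {zf : ZF M}.
Context {A B C D : Type} {sA : small M A} {sB : small M B} {sC : small M C}.
Context {sD : small M D}.

Lemma def_comp2 (P : B -> C -> Prop) (f : A -> B) (g : A -> C) :
  definable (fun p : B * C => P p.1 p.2) -> dfun f -> dfun g ->
  definable (fun x => P (f x) (g x)).
Proof. by move=> dP df dg; apply: (def_comp (dfun_pair df dg) dP). Qed.

Lemma dfun_comp2 (F : B -> C -> D) (f : A -> B) (g : A -> C) :
  dfun (fun p : B * C => F p.1 p.2) -> dfun f -> dfun g ->
  dfun (fun x => F (f x) (g x)).
Proof. by move=> dF df dg; apply: (dfun_compose (dfun_pair df dg) dF). Qed.

Lemma def_mem (f : A -> B) (g : A -> C) :
  dfun f -> dfun g -> definable (fun x => emb (f x) ∈ emb (g x)).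
Proof.
by move=> df dg; apply: (def_comp2 (P := fun x y => emb x ∈ emb y)) => //;
  exact: def_mem_pair.
Qed.

Lemma def_mem_cst (f : A -> B) (c : M) :
  dfun f -> definable (fun x => emb (f x) ∈ c).
Proof. by move=> df; apply: (def_comp (P := fun y => emb y ∈ c) df); exists c. Qed.

End Terms.

Lemma def_eq {M : structure} {zf : ZF M} {A B : Type} {sA : small M A}
    {sB : small M B} (f g : A -> B) :
  dfun f -> dfun g -> definable (fun x => f x = g x).
Proof.
move=> df dg; apply: (def_comp2 (P := fun x y => x = y)) => //.
by apply: (definable_ext _ (dfun_id (A := B))) => -[x y] /=; split=> ->.
Qed.

Lemma def_comp3 {M : structure} {zf : ZF M} {A B C D : Type} {sA : small M A}
    {sB : small M B} {sC : small M C} {sD : small M D}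
    (P : B -> C -> D -> Prop) (f : A -> B) (g : A -> C) (h : A -> D) :
  definable (fun p : B * C * D => P p.1.1 p.1.2 p.2) ->
  dfun f -> dfun g -> dfun h -> definable (fun x => P (f x) (g x) (h x)).
Proof.
by move=> dP df dg dh; apply: (def_comp (dfun_pair (dfun_pair df dg) dh) dP).
Qed.

Lemma dfun_if {M : structure} {zf : ZF M} {A B : Type} {sA : small M A}
    {sB : small M B} (b : A -> bool) (f g : A -> B) :
  definable (fun x => is_true (b x)) -> dfun f -> dfun g ->
  dfun (fun x => if b x then f x else g x).
Proof.
move=> db df dg; apply: (definable_ext (Q := fun p : A * B =>
  (is_true (b p.1) /\ p.2 = f p.1) \/ (~ is_true (b p.1) /\ p.2 = g p.1))).
  by case=> x y /=; case: (b x); split=> [|[[]|[]]] //; auto.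
apply: def_or; apply: def_and => //.
- exact: (def_comp (P := fun x => is_true (b x)) dfun_fst).
- by apply: def_not; exact: (def_comp (P := fun x => is_true (b x)) dfun_fst).
Qed.

(* Automatic proofs of definability *)
Create HintDb def.

Ltac def_db := solve [auto 1 with def nocore].

(* Redefined below, once the real numbers of M are available. *)
Ltac def_real := fail.

(** Defined notions are looked up in the database [def], where they are stated on products;
    [def_comp2], [def_comp3] and [dfun_comp2] lead from curried occurrences to these statements. *)
Ltac def_atom :=
  match goal with
  | |- _ => assumption
  | |- definable (fun g => ?P (@?s g)) =>
      apply: (def_comp (f := s) (P := P)); last def_db
  | |- definable (fun g => ?P (@?s g) (@?t g)) =>
      apply: (def_comp2 (f := s) (g := t) (P := P)); first def_db
  | |- definable (fun g => ?P (@?s g) (@?t g) (@?u g)) =>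
      apply: (def_comp3 (f := s) (g := t) (h := u) (P := P)); first def_db
  | |- dfun (fun g => ?F (@?s g)) =>
      apply: (dfun_compose (f := s) (g := F)); last def_db
  | |- dfun (fun g => ?F (@?s g) (@?t g)) =>
      apply: (dfun_comp2 (f := s) (g := t) (F := F)); first def_db
  | |- dfun _ => apply: dfun_if
  end.

Ltac def_step :=
  lazymatch goal with
  | |- definable (fun _ => ?P) => apply: def_cst
  | |- definable (fun g => ~ (@?P g)) => apply: (def_not (P := P))
  | |- definable (fun g => (@?P g) /\ (@?Q g)) => apply: (def_and (P := P) (Q := Q))
  | |- definable (fun g => (@?P g) \/ (@?Q g)) => apply: (def_or (P := P) (Q := Q))
  | |- definable (fun g => (@?P g) <-> (@?Q g)) => apply: (def_iff (P := P) (Q := Q))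
  | |- definable (fun g => (@?P g) -> (@?Q g)) => apply: (def_imp (P := P) (Q := Q))
  | |- definable (fun g => exists y, @?P g y) => apply: (def_ex (P := P))
  | |- definable (fun g => forall y, @?P g y) => apply: (def_all (P := P))
  | |- definable (fun g => (@?s g) = (@?t g)) => apply: (def_eq (f := s) (g := t))
  | |- definable (fun g => emb (@?s g) ∈ emb (@?t g)) =>
      apply: (def_mem (f := s) (g := t))
  | |- definable (fun g => emb (@?s g) ∈ val (@?t g)) =>
      apply: (def_mem (f := s) (g := t))
  | |- definable (fun g => emb (@?s g) ∈ ?c) =>
      apply: (def_mem_cst (f := s))
  | |- dfun (fun _ => ?c) => apply: dfun_cst
  | |- dfun (fun g => g) => apply: dfun_id
  | |- dfun (fun g => fst (@?s g)) =>
      first [apply: dfun_fst | apply: (dfun_compose (f := s) (g := fst)); last apply: dfun_fst]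
  | |- dfun (fun g => snd (@?s g)) =>
      first [apply: dfun_snd | apply: (dfun_compose (f := s) (g := snd)); last apply: dfun_snd]
  | |- dfun (fun g => ((@?s g), (@?t g))) => apply: (dfun_pair (f := s) (g := t))
  | |- definable (fun _ => _) => first [def_real | def_atom]
  | |- dfun (fun _ => _) => first [def_real | def_atom]
  | |- definable ?P => first [assumption | change (definable (fun x => P x))]
  | |- dfun ?f => first [assumption | change (dfun (fun x => f x))]
  end.
Ltac def := repeat (cbv beta; def_step).

(** * Functions that belong to the model *)

Section FnSec.
Context {M : structure} {zf : ZF M}.

(** This is how a function picked by the choice operator of the metatheory becomes a function of
    [M]: a definable condition determines its values, so the choice leaves no trace in the graph. *)
Lemma dfun_char {A B : Type} {sA : small M A} {sB : small M B} (f : A -> B)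
    (Q : A -> B -> Prop) :
  definable (fun p : A * B => Q p.1 p.2) -> (forall x y, y = f x <-> Q x y) ->
  dfun f.
Proof. by move=> dQ fQ; apply: (definable_ext _ dQ) => -[x y] /=. Qed.

Section Fn.
Context {A B : Type} {sA : small M A} {sB : small M B}.

(** These functions form a small type, so definable conditions may quantify over loops, homotopies
    and sequences. *)
Definition Fn := El (expo (car A) (car B)).

Lemma Fn_fun (f : Fn) : is_fun (val f) (car A) (car B).
Proof. by have := valP f; have := expoP (car A) (car B) (val f) => ->. Qed.

Lemma ap_ex (f : Fn) (a : A) : exists b : B, rel (val f) (emb a) (emb b).
Proof.
have [H1 H2] := Fn_fun f; have [b [Hb _]] := H2 _ (emb_car a).
move/relE: (Hb) => /H1 [a' [b' [_ [+ /is_opairE /opair_inj [_ E]]]]].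
by rewrite -E => /carP [b'' E']; exists b''; rewrite E'.
Qed.

Definition ap (f : Fn) (a : A) : B := sval (cid (ap_ex f a)).

Lemma apP (f : Fn) a b : opair (emb a) (emb b) ∈ val f <-> ap f a = b.
Proof.
have := svalP (cid (ap_ex f a)); rewrite -/(ap f a) => H; split=> [|<-]; last exact/relE.
move/relE=> Hb; have [_ /(_ _ (emb_car a)) [b' [_ Hu]]] := Fn_fun f.
by apply: emb_inj; rewrite -(Hu _ H) -(Hu _ Hb).
Qed.

Lemma rel_ap (f : Fn) a b : rel (val f) (emb a) (emb b) <-> ap f a = b.
Proof. by rewrite relE apP. Qed.

Lemma Fn_ext (f g : Fn) : (forall a, ap f a = ap g a) -> f = g.
Proof.
move=> H; apply: val_inj; apply: ext => p.
have aux (h k : Fn) : (forall a, ap h a = ap k a) -> p ∈ val h -> p ∈ val k.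
  move=> E ph; case: (Fn_fun h) => /(_ _ ph) + _.
  move=> [a' [b' [/carP [a <-] [/carP [b <-] /is_opairE pE]]]]; subst p.
  by apply/apP; rewrite -E; apply/apP.
by split; apply: aux.
Qed.

Lemma lam_ex (F : A -> B) : dfun F -> exists f : Fn, forall a, ap f a = F a.
Proof.
case=> s sF.
have [f Hf] := @separation _ _ (fun e => e 0 ∈ e 1) (fun _ => s)
  (prod (car A) (car B)) ltac:(by express).
have fE a b : opair (emb a) (emb b) ∈ f <-> b = F a.
  rewrite Hf /= -(sF (a, b)) /=; split=> [[]//|->]; split=> //.
  by apply: (emb_car (a, F a)).
have fF : f ∈ expo (car A) (car B).
  apply/expoP; split.
    move=> p /Hf [/prodE [a [b [? ? ->]]] _].
    by exists a, b; rewrite is_opairE.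
  move=> _ /carP [a <-]; exists (emb (F a)); split; first by apply/relE/fE.
  move=> y /relE ypf; have [/prodE [? [b [_ yB /opair_inj [_ ?]]]] _] := iffLR (Hf _) ypf.
  by subst b; case/carP: yB ypf => b <- /fE ->.
by exists (MkEl f fF) => a; apply/apP/fE.
Qed.

Definition lam (F : A -> B) (dF : dfun F) : Fn := sval (cid (lam_ex dF)).

Lemma lamE (F : A -> B) (dF : dfun F) a : ap (lam dF) a = F a.
Proof. by rewrite /lam; case: cid. Qed.

Lemma FnP f : is_fun f (car A) (car B) <-> exists F : Fn, val F = f.
Proof.
split=> [H|[F <-]]; last exact: Fn_fun.
have Hf : f ∈ expo (car A) (car B) by apply/expoP.
by exists (MkEl f Hf).
Qed.

End Fn.
Arguments Fn A B {sA sB}.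

#[global] Instance small_Fn A B {sA : small M A} {sB : small M B} :
  small M (Fn A B) := small_El _.

Lemma dfun_ap_pair {A B : Type} {sA : small M A} {sB : small M B} :
  dfun (fun p : Fn A B * A => ap p.1 p.2).
Proof.
apply: (@dfun_char _ _ _ _ _ (fun p b => emb (p.2, b) ∈ emb p.1)); first by def.
by move=> [f a] b /=; rewrite (apP f); split=> ->.
Qed.

(** Unlike the witness in [definable], this set contains nothing but codes, as open sets and
    preimages require. *)
Lemma subset_car {A} {sA : small M A} (P : A -> Prop) : definable P ->
  exists B, B ⊆ car A /\ forall x : A, emb x ∈ B <-> P x.
Proof.
case=> s sP; have [b Hb] := @separation _ _ (fun e => e 0 ∈ e 1) (fun _ => s)
  (car A) ltac:(by express).
exists b; split=> [z /Hb[]//|x]; rewrite Hb sP.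
by split=> [[]//|?]; split=> //; exact: emb_car.
Qed.

End FnSec.
Arguments Fn {M zf} A B {sA sB}.
#[global] Hint Resolve dfun_ap_pair : def.

(** * Natural numbers of the model *)

Section Naturals.
Context {M : structure} {zf : ZF M} {S : standard_sets M}.

Definition Nn := El (omega S).
#[global] Instance small_Nn : small M Nn := small_El _.

Lemma zeroN_ex : exists n : Nn, is_empty (val n).
Proof. by have [[[e [He ew]] _] _] := omegaP S; exists (MkEl e ew). Qed.
Definition zeroN : Nn := sval (cid zeroN_ex).

Lemma succN_ex (n : Nn) : exists m : Nn, is_succ (val m) (val n).
Proof.
have [[_ H] _] := omegaP S; have [s [Hs sw]] := H _ (valP n).
by exists (MkEl s sw).
Qed.
Definition succN n : Nn := sval (cid (succN_ex n)).

Definition lto (n m : Nn) := emb n ∈ emb m.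
Local Notation "n ≺ m" := (lto n m) (at level 70).
Definition leo (n m : Nn) := n ≺ succN m.
Local Notation "n ≼ m" := (leo n m) (at level 70).

Lemma ltoN0 n : ~ n ≺ zeroN.
Proof. by rewrite /lto /zeroN; case: cid => /= z; apply. Qed.

Lemma succP n : is_succ (val (succN n)) (val n).
Proof. by rewrite /succN; case: cid. Qed.

Lemma succ_uniq (m n : Nn) : is_succ (val m) (val n) -> m = succN n.
Proof. by move=> H; apply: val_inj; apply: ext => z; rewrite (H z) (succP n z). Qed.

Lemma leoE n m : n ≼ m <-> n ≺ m \/ n = m.
Proof.
rewrite /leo /lto (succP m (val n)); split=> -[]; auto.
  by move/val_inj; right.
by move=> ->; right.
Qed.

(** The omega of [M] is least only among the inductive sets of [M], so the extension of [P] must be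
    one of these sets. Every use below begins by discharging this obligation. *)
Lemma indN (P : Nn -> Prop) : definable P -> P zeroN ->
  (forall n, P n -> P (succN n)) -> forall n, P n.
Proof.
move=> dP P0 PS n; have [b [bw Hb]] := subset_car dP.
apply/Hb; have [_] := omegaP S; apply; last exact: valP.
split=> [|m mb].
  exists (val zeroN); split; first by rewrite /zeroN; case: cid.
  exact/Hb.
exists (val (succN (MkEl m (bw _ mb)))); split; first exact: (succP (MkEl m _)).
by apply/Hb/PS/Hb.
Qed.

Lemma dfun_succ : dfun succN.
Proof.
apply: (@definable_sep _ _ _ _ _ (fun e => exists n m, is_opair (e 0) n m /\
  forall z, z ∈ m <-> z ∈ n \/ z = n) (fun _ => car Nn) ltac:(by express)).
move=> [n m] /=; split=> [->|].
  by exists (val n), (val (succN n)); rewrite is_opairE; split=> //; exact: succP.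
case=> n' [m' [/is_opairE /opair_inj [<- <-]]]; exact: succ_uniq.
Qed.

#[local] Hint Resolve dfun_succ : def.

Lemma def_lto : definable (fun p : Nn * Nn => p.1 ≺ p.2).
Proof. by rewrite /lto; def. Qed.

Lemma def_leo : definable (fun p : Nn * Nn => p.1 ≼ p.2).
Proof. by rewrite /leo /lto; def. Qed.

End Naturals.
#[global] Hint Resolve dfun_succ def_lto def_leo : def.

Notation "n ≺ m" := (lto n m) (at level 70).
Notation "n ≼ m" := (leo n m) (at level 70).

Section NaturalOrder.
Context {M : structure} {zf : ZF M} {S : standard_sets M}.
Implicit Types k m n : Nn.

Lemma lto_succ n : n ≺ succN n. Proof. by apply/leoE; right. Qed.
Lemma leo_refl n : n ≼ n. Proof. exact: lto_succ. Qed.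
Lemma ltoW n m : n ≺ m -> n ≼ m. Proof. by move=> ?; apply/leoE; left. Qed.

Lemma lto_trans m k n : k ≺ m -> m ≺ n -> k ≺ n.
Proof.
move=> km; move: n; apply: indN; first by def.
  by move/ltoN0.
move=> n IH /leoE [/IH|<-]; exact: ltoW.
Qed.

Lemma lto_irr n : ~ n ≺ n.
Proof.
move: n; apply: indN; [by def|exact: ltoN0|].
move=> n IH /leoE [H|H]; last by apply: IH; rewrite -{2}H; exact: lto_succ.
by apply: IH; apply: lto_trans H; exact: lto_succ.
Qed.

Lemma leo_lto_trans m k n : k ≼ m -> m ≺ n -> k ≺ n.
Proof. by case/leoE=> [|-> //]; exact: lto_trans. Qed.
Lemma lto_leo_trans m k n : k ≺ m -> m ≼ n -> k ≺ n.
Proof. by move=> km /leoE [|<- //]; exact: lto_trans. Qed.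
Lemma leo_trans m k n : k ≼ m -> m ≼ n -> k ≼ n.
Proof. by move=> km mn; apply: leo_lto_trans km mn. Qed.

Lemma le0N n : zeroN ≼ n.
Proof.
move: n; apply: indN; [by def|exact: leo_refl|].
by move=> n H; apply: leo_trans H (ltoW (lto_succ n)).
Qed.

Lemma succ_leo n m : n ≺ m -> succN n ≼ m.
Proof.
move: m; apply: indN; [by def|by move/ltoN0|].
move=> m IH /leoE [/IH H|->]; last exact: leo_refl.
exact: ltoW.
Qed.

Lemma leo_or_lto n m : n ≼ m \/ m ≺ n.
Proof.
move: n; apply: indN; [by def|by left; exact: le0N|].
move=> n [/leoE[/succ_leo|->]|H]; [by left|by right; exact: lto_succ|].
by right; apply: lto_trans H (lto_succ n).
Qed.

Lemma lto_total n m : n ≺ m \/ n = m \/ m ≺ n.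
Proof. by case: (leo_or_lto n m) => [/leoE[]|]; auto. Qed.

Lemma leo_lto_false n m : n ≼ m -> m ≺ n -> False.
Proof. by move=> H H'; apply: (@lto_irr n); apply: leo_lto_trans H H'. Qed.

Lemma lto_leo_false n m : n ≺ m -> m ≼ n -> False.
Proof. by move=> H H'; apply: leo_lto_false H' H. Qed.

Lemma succ_lto n m : n ≺ m -> succN n ≺ succN m.
Proof. exact: succ_leo. Qed.

Lemma succ_inj n m : succN n = succN m -> n = m.
Proof.
move=> E; have /leoE [H|//] : n ≼ m by rewrite /leo -E; exact: lto_succ.
by case: (@lto_leo_false n m) => //; rewrite /leo E; exact: lto_succ.
Qed.

Lemma maxN_ex n m : exists k, n ≼ k /\ m ≼ k.
Proof.
case: (leo_or_lto n m) => H; first by exists m; split=> //; exact: leo_refl.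
by exists n; split; [exact: leo_refl | exact: ltoW].
Qed.

Lemma mono_leo (P : Nn -> Nn -> Prop) : definable (fun p : Nn * Nn => P p.1 p.2) ->
  (forall n, P n n) -> (forall n m, P n m -> P n (succN m)) ->
  forall n m, n ≼ m -> P n m.
Proof.
move=> dP P0 PS n; apply: indN.
- by def.
- by case/leoE=> [/ltoN0|->].
- by move=> m IH /leoE [/IH/PS|->].
Qed.

End NaturalOrder.

(** * Cantor space, dependent choice and countable families *)

Section Cantor.
Context {M : structure} {zf : ZF M} {S : standard_sets M}.

Definition Two := El (two S).
#[global] Instance small_Two : small M Two := small_El _.

Lemma two_ex : exists o i : Two, o <> i /\ forall b : Two, b = o \/ b = i.
Proof.
have [o [i [Ho [Hi H]]]] := twoP S.
have oP : o ∈ two S by apply/H; left.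
have iP : i ∈ two S by apply/H; right.
exists (MkEl o oP), (MkEl i iP); split=> [[E]|b].
  by apply: (Ho o); rewrite {2}E; apply/Hi; right.
by case/H: (valP b) => E; [left|right]; apply: val_inj.
Qed.

Definition twoZ : Two := sval (cid two_ex).
Definition twoI : Two := sval (cid (svalP (cid two_ex))).
Lemma two_neq : twoZ <> twoI.
Proof. exact: (svalP (cid (svalP (cid two_ex)))).1. Qed.
Lemma two_cases b : b = twoZ \/ b = twoI.
Proof. exact: (svalP (cid (svalP (cid two_ex)))).2. Qed.

Definition Can := El (cantor S).
#[global] Instance small_Can : small M Can := small_El _.

(** Digits as propositions: by [Can_ext] and [Can_ex] points of the Cantor space then behave like
    definable subsets of omega. *)
Definition bit (a : Can) (n : Nn) : Prop := emb (n, twoI) ∈ emb a.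

Lemma cantorE : cantor S = expo (car Nn) (car Two).
Proof. by apply: ext => f; rewrite (cantorP S f) (expoP (car Nn) (car Two) f). Qed.

Lemma Can_FnP (a : Can) : exists f : Fn Nn Two, val f = val a.
Proof.
have H : val a ∈ expo (car Nn) (car Two) by rewrite -cantorE; exact: valP.
by exists (MkEl _ H).
Qed.

Lemma Can_ext (a b : Can) : (forall n, bit a n <-> bit b n) -> a = b.
Proof.
have [[f Ef] [g Eg]] := (Can_FnP a, Can_FnP b).
move=> H; apply: val_inj; rewrite -Ef -Eg; congr val; apply: Fn_ext => n.
move: (H n); rewrite /bit /= -Ef -Eg (apP f n twoI) (apP g n twoI).
by case: (two_cases (ap f n)) (two_cases (ap g n)) => -> [] -> [] // E E';
  [exact: E'|symmetry; exact: E].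
Qed.

Lemma Can_ex (P : Nn -> Prop) : definable P -> exists a : Can, forall n, bit a n <-> P n.
Proof.
move=> dP; pose F n := if `[< P n >] then twoI else twoZ.
have FE n b : b = F n <-> (P n /\ b = twoI) \/ (~ P n /\ b = twoZ).
  rewrite /F; case: asboolP => H; split; auto; by case=> -[].
have dF : dfun F.
  apply: (dfun_char _ FE).
  by def.
have H : val (lam dF) ∈ cantor S by rewrite cantorE; exact: valP.
exists (MkEl _ H) => n; rewrite /bit /= (apP (lam dF) n twoI) lamE.
split=> [E|Pn]; last by symmetry; apply/FE; left.
by case/FE: (esym E) => -[//] _ E'; case: two_neq.
Qed.

Definition mkCan (P : Nn -> Prop) (dP : definable P) : Can := sval (cid (Can_ex dP)).
Lemma mkCanE (P : Nn -> Prop) (dP : definable P) n : bit (mkCan dP) n <-> P n.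
Proof. by rewrite /mkCan; case: cid. Qed.

Lemma def_bit : definable (fun p : Can * Nn => bit p.1 p.2).
Proof. by rewrite /bit; def. Qed.

(** As in the axiom, the first value cannot be prescribed: the element of [A] only shows that the
    set is nonempty. The constructions below are arranged to tolerate an arbitrary start. *)
Lemma dependent_choice {A} {sA : small M A} (R : A -> A -> Prop) :
  DC S -> A -> definable (fun p : A * A => R p.1 p.2) ->
  (forall x, exists y, R x y) ->
  exists z : Fn Nn A, forall n, R (ap z n) (ap z (succN n)).
Proof.
move=> dc a0 [s sR] Rtot.
have [r Hr] := @separation _ _ (fun e => e 0 ∈ e 1) (fun _ => s)
  (prod (car A) (car A)) ltac:(by express).
have rE x y : rel r (emb x) (emb y) <-> R x y.
  rewrite relE Hr /= (sR (x, y)); split=> [[]//|]; split=> //.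
  exact: (emb_car (x, y)).
have ne : exists x, x ∈ car A by exists (emb a0); exact: emb_car.
have rsub : r ⊆ prod (car A) (car A) by move=> z /Hr [].
have tot x : x ∈ car A -> exists y, y ∈ car A /\ rel r x y.
  move=> /carP [x' <-]; have [y Rxy] := Rtot x'.
  by exists (emb y); split; [exact: emb_car | exact/rE].
have [z [zF Hz]] := dc (car A) r (prod (car A) (car A)) ne (prodP _ _) rsub tot.
have zF' : is_fun z (car Nn) (car A) by [].
have [f fz] := iffLR (FnP z) zF'; exists f => n.
apply/rE; apply: (Hz (val n) (val (succN n))); rewrite -?fz.
- exact: valP.
- exact: succP.
- exact/(rel_ap f n).
- exact/(rel_ap f (succN n)).
Qed.

(** Families are indexed by an injection into omega instead of being enumerated, so the empty family
    is no special case; in return an index may belong to no member. *)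
Lemma countable_index (F : M) : countable S F ->
  exists idx : Fn (El F) Nn, forall N N', ap idx N = ap idx N' -> N = N'.
Proof.
move=> [j [jF j_inj]]; have jF' : is_fun j (car (El F)) (car Nn) by [].
have [idx idxE] := iffLR (FnP j) jF'; exists idx => N N' EN.
apply: val_inj; apply: (j_inj _ _ (val (ap idx N))); rewrite -idxE.
  exact/(rel_ap idx N).
exact/(rel_ap idx N').
Qed.

End Cantor.
#[global] Hint Resolve def_bit : def.

(** * Real numbers *)

(* The argument [zf] lets canonical structures on this type recover the proof
   of ZF on which its operations depend. *)
Definition Rc {M : structure} {zf : ZF M} {S : standard_sets M} : Type :=
  El (reals S).

Section ConcreteReals.
Context {M : structure} {zf : ZF M} {S : standard_sets M}.

#[global] Instance small_Rc : small M Rc := small_El _.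

Local Notation RS := (realsP S).

Lemma binop_ex (op : M) : (exists Q, is_prod Q (reals S) (reals S) /\ is_fun op Q (reals S)) ->
  exists f : Fn (Rc * Rc) Rc, val f = op.
Proof.
case=> Q [/is_prodE -> H]; have H' : is_fun op (car (Rc * Rc)%type) (car Rc) by [].
exact: (iffLR (FnP op) H').
Qed.

Definition addF := sval (cid (binop_ex (Defs.add_fun RS))).
Definition mulF := sval (cid (binop_ex (Defs.mul_fun RS))).
Definition addM (a b : Rc) : Rc := ap addF (a, b).
Definition mulM (a b : Rc) : Rc := ap mulF (a, b).
Definition zeroM : Rc := MkEl (rzero S) (zero_in RS).
Definition oneM : Rc := MkEl (rone S) (one_in RS).
Definition ltM (a b : Rc) : Prop := rel (rlt S) (val a) (val b).

Lemma addME a b c : rel2 (radd S) (val a) (val b) (val c) <-> addM a b = c.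
Proof.
rewrite /rel2 -(svalP (cid (binop_ex (Defs.add_fun RS)))) -/addF.
split=> [[p [/is_opairE ->]]|H]; first by move/(rel_ap addF (a, b)).
by exists (emb (a, b)); rewrite is_opairE; split=> //; apply/(rel_ap addF (a, b)).
Qed.

Lemma mulME a b c : rel2 (rmul S) (val a) (val b) (val c) <-> mulM a b = c.
Proof.
rewrite /rel2 -(svalP (cid (binop_ex (Defs.mul_fun RS)))) -/mulF.
split=> [[p [/is_opairE ->]]|H]; first by move/(rel_ap mulF (a, b)).
by exists (emb (a, b)); rewrite is_opairE; split=> //; apply/(rel_ap mulF (a, b)).
Qed.

Lemma ltME a b : ltM a b <-> opair (emb a) (emb b) ∈ rlt S.
Proof. by rewrite /ltM relE. Qed.

Lemma addMA : associative addM.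
Proof.
move=> a b c; have H (x y : Rc) := iffRL (addME x y (addM x y)) erefl.
by apply/addME; apply: (addA RS (H _ _) (H _ _) (H _ _)).
Qed.

Lemma addMC : commutative addM.
Proof. by move=> a b; apply/addME; apply: (addC RS); apply/addME. Qed.

Lemma add0M : left_id zeroM addM.
Proof. by move=> a; apply/addME; apply: (add0 RS); exact: valP. Qed.

Lemma oppM_ex a : exists b, addM b a = zeroM.
Proof.
have [b [bR H]] := addN RS (valP a).
exists (MkEl b bR); rewrite addMC; exact/addME.
Qed.
Definition oppM a := sval (cid (oppM_ex a)).
Lemma addNM : left_inverse zeroM oppM addM.
Proof. by move=> a; rewrite /oppM; case: cid. Qed.

HB.instance Definition _ := gen_eqMixin Rc.
HB.instance Definition _ := gen_choiceMixin Rc.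
HB.instance Definition _ := GRing.isZmodule.Build Rc addMA addMC add0M addNM.

Lemma mulMA : associative mulM.
Proof.
move=> a b c; have H (x y : Rc) := iffRL (mulME x y (mulM x y)) erefl.
by apply/mulME; apply: (mulA RS (H _ _) (H _ _) (H _ _)).
Qed.

Lemma mulMC : commutative mulM.
Proof. by move=> a b; apply/mulME; apply: (mulC RS); apply/mulME. Qed.

Lemma mul1M : left_id oneM mulM.
Proof. by move=> a; apply/mulME; apply: (mul1 RS); exact: valP. Qed.

Lemma mulMDl : left_distributive mulM addM.
Proof.
move=> a b c; rewrite mulMC (mulMC a) (mulMC b); symmetry.
have Hm (x y : Rc) := iffRL (mulME x y (mulM x y)) erefl.
have Ha (x y : Rc) := iffRL (addME x y (addM x y)) erefl.
by apply/addME; apply: (distr RS (Ha _ _) (Hm _ _) (Hm _ _) (Hm _ _)).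
Qed.

Lemma oneM_neq0 : oneM != zeroM.
Proof. by apply/eqP => -[]; exact: (one_neq_zero RS). Qed.

HB.instance Definition _ :=
  GRing.Zmodule_isComNzRing.Build Rc mulMA mulMC mul1M mulMDl oneM_neq0.

Lemma invM_ex (a : Rc) : exists b : Rc,
  (a <> zeroM -> mulM b a = oneM) /\ (a = zeroM -> b = zeroM).
Proof.
case: (pselect (a = zeroM)) => H; first by exists zeroM.
have [|b [bR E]] := mulV RS (valP a); first by move=> E; apply: H; exact: val_inj.
exists (MkEl b bR); split=> // _; rewrite mulMC; exact/mulME.
Qed.
Definition invM a := sval (cid (invM_ex a)).
Lemma mulVM (x : Rc) : x != zeroM -> mulM (invM x) x = oneM.
Proof. by move/eqP => H; rewrite /invM; case: cid => b /= []; auto. Qed.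
Lemma invM0 : invM zeroM = zeroM.
Proof. by rewrite /invM; case: cid => b /= [_]; apply. Qed.

HB.instance Definition _ := GRing.ComNzRing_isField.Build Rc mulVM invM0.

Definition ltMb (a b : Rc) := `[< ltM a b >].
Definition leMb (a b : Rc) := (a == b) || ltMb a b.
Definition normM (a : Rc) := if ltMb a 0%R then (- a)%R else a.

Lemma ltM_add a b c : ltM a b -> ltM (addM a c) (addM b c).
Proof.
have Ha (x y : Rc) := iffRL (addME x y (addM x y)) erefl.
by move=> H; apply: (lt_add RS H (Ha _ _) (Ha _ _)).
Qed.

Lemma lt0_addM (x y : Rc) : ltMb 0%R x -> ltMb 0%R y -> ltMb 0%R (x + y)%R.
Proof.
move=> /asboolP Hx /asboolP Hy; apply/asboolP.
apply: (Defs.lt_trans RS Hy); rewrite -/(ltM y (x + y)%R).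
by have := ltM_add y Hx; rewrite add0M.
Qed.

Lemma lt0_mulM (x y : Rc) : ltMb 0%R x -> ltMb 0%R y -> ltMb 0%R (x * y)%R.
Proof.
move=> /asboolP Hx /asboolP Hy; apply/asboolP.
by apply: (lt_mul RS Hx Hy); apply/mulME.
Qed.

Lemma lt0_ngt0M (x : Rc) : ltMb 0%R x -> ~~ ltMb x 0%R.
Proof.
move=> /asboolP H; apply/asboolP => H'.
by apply: (lt_irr RS); apply: (Defs.lt_trans RS H H').
Qed.

Lemma sub_gt0M (x y : Rc) : ltMb 0%R (y - x)%R = ltMb x y.
Proof.
apply/asboolP/asboolP => [/(ltM_add x)|/(ltM_add (- x)%R)].
  by rewrite add0M -[addM _ x]/((y - x) + x)%R subrK.
by rewrite -[addM x _]/(x - x)%R subrr.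
Qed.

Lemma lt0_totalM (x : Rc) : x != 0%R -> ltMb 0%R x || ltMb x 0%R.
Proof.
move=> /eqP x0; case: (Defs.lt_total RS (valP (0%R : Rc)) (valP x)) => [H|[H|H]].
- by rewrite /ltMb asboolT.
- by case: x0; symmetry; apply: val_inj.
- by rewrite orbC /ltMb asboolT.
Qed.

Lemma normMN (x : Rc) : normM (- x)%R = normM x.
Proof.
rewrite /normM -(sub_gt0M (- x)%R) sub0r opprK.
case: (eqVneq x 0%R) => [->|/lt0_totalM]; first by rewrite oppr0; case: ifP.
case/orP => H; last first.
  by rewrite H; case: ifP => // H'; have := lt0_ngt0M H'; rewrite H.
by rewrite H; have := lt0_ngt0M H; case: ifP.
Qed.

Lemma ge0_normM (x : Rc) : leMb 0%R x -> normM x = x.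
Proof.
rewrite /normM => /orP [/eqP <-|/lt0_ngt0M]; last by case: ifP.
by rewrite oppr0; case: ifP.
Qed.

HB.instance Definition _ := Num.IntegralDomain_isLtReal.Build Rc
  lt0_addM lt0_mulM lt0_ngt0M sub_gt0M lt0_totalM normMN ge0_normM
  (fun _ _ => erefl).

Local Open Scope ring_scope.

Lemma ltcE (x y : Rc) : x < y <-> ltM x y.
Proof. by split=> [/asboolP|H] //; apply/asboolP. Qed.

(** All that is kept of the concrete field: the graphs of the operations and of the order are sets
    of [M], which makes arithmetic definable. *)
Record is_model (K : realFieldType) (e : K -> M) : Prop := IsModel {
  model_inj : forall a b, e a = e b -> a = b;
  model_car : forall m, m ∈ reals S <-> exists a, e a = m;
  model_0 : e 0 = rzero S;
  model_1 : e 1 = rone S;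
  model_add : forall a b c, opair (opair (e a) (e b)) (e c) ∈ radd S <-> c = a + b;
  model_mul : forall a b c, opair (opair (e a) (e b)) (e c) ∈ rmul S <-> c = a * b;
  model_lt : forall a b, opair (e a) (e b) ∈ rlt S <-> a < b
}.

Lemma model_ex : exists K : {K : realFieldType & K -> M}, is_model (projT2 K).
Proof.
exists (existT (fun K : realFieldType => K -> M) (Rc : realFieldType) (@emb M Rc _)).
have rel2E op (a b c : Rc) : rel2 op (val a) (val b) (val c) <->
    opair (opair (emb a) (emb b)) (emb c) ∈ op.
  rewrite /rel2; split=> [[p [/is_opairE -> /relE]] //|H].
  by exists (opair (emb a) (emb b)); rewrite is_opairE relE.
split=> /=.
- exact: val_inj.
- exact: El_carP.
- by [].
- by [].
- by move=> a b c; rewrite -rel2E addME; split=> [<-|->].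
- by move=> a b c; rewrite -rel2E mulME; split=> [<-|->].
- by move=> a b; rewrite -ltME; apply: iff_sym; exact: ltcE.
Qed.

(* The type obtained by choice does not reduce: unification never unfolds its
   arithmetic. *)
Definition Rf : realFieldType := projT1 (sval (cid model_ex)).
Definition real_emb : Rf -> M := projT2 (sval (cid model_ex)).
Lemma real_model : is_model real_emb.
Proof. exact: (svalP (cid model_ex)). Qed.

End ConcreteReals.

Notation Rm := (Num.RealField.sort Rf).

Section Reals.
Context {M : structure} {zf : ZF M} {S : standard_sets M}.
Local Open Scope ring_scope.

#[global] Instance small_Rm : small M Rm :=
  Small (model_inj real_model) (model_car real_model).

Lemma real_carP m : m ∈ reals S <-> exists a : Rm, emb a = m.
Proof. exact: (model_car real_model). Qed.

Lemma ltRE (x y : Rm) : rel (rlt S) (emb x) (emb y) <-> x < y.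
Proof. by rewrite relE; exact: (model_lt real_model). Qed.

Section DefReal.
Context {A : Type} {sA : small M A}.
Implicit Types f g : A -> Rm.

Lemma dfun_addR f g : dfun f -> dfun g -> dfun (fun x => f x + g x).
Proof.
move=> df dg; apply: (dfun_char (Q := fun x c => emb ((f x, g x), c) ∈ radd S)).
  by def.
by move=> x c; apply: iff_sym; exact: (model_add real_model).
Qed.

Lemma dfun_mulR f g : dfun f -> dfun g -> dfun (fun x => f x * g x).
Proof.
move=> df dg; apply: (dfun_char (Q := fun x c => emb ((f x, g x), c) ∈ rmul S)).
  by def.
by move=> x c; apply: iff_sym; exact: (model_mul real_model).
Qed.

End DefReal.

Section DefRealField.
Context {A : Type} {sA : small M A}.
Implicit Types f g : A -> Rm.

Lemma dfun_oppR f : dfun f -> dfun (fun x => - f x).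
Proof.
move=> df; apply: (dfun_char (Q := fun x y => y + f x = 0)).
  by apply: def_eq; [apply: dfun_addR; def | def].
move=> x y; split=> [->|H]; first by rewrite addNr.
by apply/eqP; rewrite -addr_eq0; apply/eqP.
Qed.

Lemma dfun_invR f : dfun f -> dfun (fun x => (f x)^-1).
Proof.
move=> df; apply: (dfun_char (Q := fun x y =>
  (f x = 0 /\ y = 0) \/ (f x <> 0 /\ f x * y = 1))).
  have dm : dfun (fun p : A * Rm => f p.1 * p.2) by apply: dfun_mulR; def.
  by def.
move=> x y; split=> [->|[[-> ->]|[/eqP fx0 H]]].
- case: (eqVneq (f x) 0) => [->|fx0]; first by left; rewrite invr0.
  by right; rewrite divff //; split=> //; exact/eqP.
- by rewrite invr0.
- by apply: (mulfI fx0); rewrite H divff.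
Qed.

Lemma def_ltR f g : dfun f -> dfun g -> definable (fun x => f x < g x).
Proof.
move=> df dg; apply: (definable_ext (Q := fun x => emb (f x, g x) ∈ rlt S)).
  by move=> x; rewrite -ltRE relE.
by def.
Qed.

Lemma def_leR f g : dfun f -> dfun g -> definable (fun x => f x <= g x).
Proof.
move=> df dg; apply: (definable_ext (Q := fun x => ~ g x < f x)).
  by move=> x; rewrite (rwP negP) -leNgt.
by apply: def_not; apply: def_ltR.
Qed.

End DefRealField.
End Reals.

Ltac def_real ::=
  lazymatch goal with
  | |- definable (fun g => is_true (Order.lt (@?s g) (@?t g))) =>
      apply: (def_ltR (f := s) (g := t))
  | |- definable (fun g => is_true (Order.le (@?s g) (@?t g))) =>
      apply: (def_leR (f := s) (g := t))
  | |- dfun (fun g => GRing.add (@?s g) (@?t g)) =>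
      apply: (dfun_addR (f := s) (g := t))
  | |- dfun (fun g => GRing.mul (@?s g) (@?t g)) =>
      apply: (dfun_mulR (f := s) (g := t))
  | |- dfun (fun g => GRing.opp (@?s g)) => apply: (dfun_oppR (f := s))
  | |- dfun (fun g => GRing.inv (@?s g)) => apply: (dfun_invR (f := s))
  end.

(** * Topologies *)

Section GeneratedTopology.
Context {M : structure} {zf : ZF M}.

Lemma sub_ext {A} {sA : small M A} (U V : M) : U ⊆ car A -> V ⊆ car A ->
  (forall x : A, emb x ∈ U <-> emb x ∈ V) -> U = V.
Proof.
move=> UA VA H; apply: ext => z.
by split=> Hz; [case/carP: (UA _ Hz) | case/carP: (VA _ Hz)] => p pz;
  subst z; apply/H.
Qed.

Lemma inter_topology (X T : M) (U V : El T) : topology X T ->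
  exists W : El T, forall z, z ∈ val W <-> z ∈ val U /\ z ∈ val V.
Proof.
move=> [_ [_ [_ [_ H]]]].
have [W HW] := @separation _ _ (fun e => e 0 ∈ e 1) (fun _ => val V)
  (val U) ltac:(by express).
by exists (MkEl W (H _ _ W (valP U) (valP V) HW)).
Qed.

(** Here [cyl j p] is a basic neighborhood of [p]. The sets that contain a cylinder around each of
    their points form a topology containing the subbasis, hence containing [T]. Conversely such a
    set is the union of all members of [T] inside it; taking all of them avoids choosing a
    neighborhood for each point. *)
Lemma generated_open {A J : Type} {sA : small M A} {sJ : small M J}
    (cyl : J -> A -> A -> Prop) (B : M -> Prop) (T : M) (j0 : J) :
  definable (fun p : J * A * A => cyl p.1.1 p.1.2 p.2) ->
  (forall j p, cyl j p p) ->
  (forall j1 j2, exists j, forall p q, cyl j p q -> cyl j1 p q /\ cyl j2 p q) ->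
  generated_topology (car A) B T ->
  (forall U, B U -> U ⊆ car A) ->
  (forall U p, B U -> emb p ∈ U -> exists j, forall q, cyl j p q -> emb q ∈ U) ->
  (forall j p, exists W : El T,
     emb p ∈ val W /\ forall q : A, emb q ∈ val W -> cyl j p q) ->
  forall U, U ∈ T <-> U ⊆ car A /\
    forall p : A, emb p ∈ U -> exists j, forall q, cyl j p q -> emb q ∈ U.
Proof.
move=> dcyl cylxx cylI [topT [BT genT]] BA Bcyl cylT U.
have [UA [e0 [AT [cupT capT]]]] := topT.
split=> [UT|[UsA HU]]; last first.
  have [F [FT HF]] := @subset_car _ _ (El T) _
    (fun W => forall q : A, emb q ∈ emb W -> emb q ∈ U) ltac:(by def).
  apply: (cupT F) => // z; split=> [zU|[V [VF zV]]].
    have /carP [p pz] := UsA _ zU; subst z.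
    have [j Hj] := HU _ zU; have [W [pW HW]] := cylT j p.
    by exists (val W); split=> //; apply/HF => q /HW; exact: Hj.
  have /El_carP [W WV] := FT _ VF; subst V.
  have /carP [p pz] := UA _ (valP W) _ zV; subst z.
  by move/HF: VF => /(_ p zV).
have [T' [T'sub HT']] := @subset_car _ _ (El (power (car A))) _
  (fun V => forall p : A, emb p ∈ emb V ->
     exists j, forall q, cyl j p q -> emb q ∈ emb V) ltac:(by def).
have T'E V : V ∈ T' <-> V ⊆ car A /\ forall p : A, emb p ∈ V ->
    exists j, forall q, cyl j p q -> emb q ∈ V.
  split=> [VT'|[VA HV]].
    have /El_carP [W E] := T'sub _ VT'; subst V.
    by split; [exact/powerP/valP | move/HT': VT'].
  have Vp : V ∈ power (car A) by apply/powerP.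
  by apply/(HT' (MkEl V Vp)).
apply/T'E; apply: (genT T' _ _ _ UT) => [|V BV]; last first.
  by apply/T'E; split; [exact: BA | move=> p; exact: Bcyl].
split; [by move=> V /T'E []|split; [|split; [|split]]].
- by move=> e He; apply/T'E; split=> [z /He|p /He].
- by apply/T'E; split=> // p _; exists j0 => q _; exact: emb_car.
- move=> F V FT' VF; apply/T'E; split=> [z /VF [W [/FT' /T'E [WA _] /WA]] //|p].
  move=> /VF [W [WF pW]]; have /T'E [_ HW] := FT' _ WF.
  by have [j Hj] := HW _ pW; exists j => q /Hj qW; apply/VF; exists W.
move=> V1 V2 W /T'E [V1A H1] /T'E [V2A H2] HW; apply/T'E; split.
  by move=> z /HW [/V1A].
move=> p /HW [/H1 [j1 Hj1] /H2 [j2 Hj2]]; have [j Hj] := cylI j1 j2.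
by exists j => q /Hj [/Hj1 q1 /Hj2 q2]; apply/HW.
Qed.

End GeneratedTopology.

(** * The unit interval and the retraction onto it *)

Section Interval.
Local Open Scope ring_scope.
Context {M : structure} {zf : ZF M} {S : standard_sets M}.

Definition Itv := El (itv S).
#[global] Instance small_Itv : small M Itv := small_El _.

Lemma real_ex (t : Itv) : exists a : Rm, emb a = val t.
Proof. by apply/real_carP; have /(itvP S) [] := valP t. Qed.

Definition rval (t : Itv) : Rm := sval (cid (real_ex t)).
Lemma emb_rval t : emb (rval t) = emb t.
Proof. exact: (svalP (cid (real_ex t))). Qed.

Lemma dfun_rval : dfun rval. Proof. by apply: dfun_emb; exact: emb_rval. Qed.

Lemma emb0 : emb (0 : Rm) = rzero S. Proof. exact: (model_0 real_model). Qed.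
Lemma emb1 : emb (1 : Rm) = rone S. Proof. exact: (model_1 real_model). Qed.

Lemma rval_inj (s t : Itv) : rval s = rval t -> s = t.
Proof. by move=> E; apply: emb_inj; rewrite -!emb_rval E. Qed.

Lemma leRE (a b : Rm) : a <= b <-> rel (rlt S) (emb a) (emb b) \/ emb a = emb b.
Proof.
rewrite le_eqVlt; split=> [/orP [/eqP ->|/ltRE]|[/ltRE ->|/emb_inj ->]].
- by right.
- by left.
- by rewrite orbT.
- by rewrite eqxx.
Qed.

Lemma mem_itv (a : Rm) : emb a ∈ itv S <-> 0 <= a /\ a <= 1.
Proof.
rewrite (itvP S) -emb0 -emb1 -!leRE; split=> [[]//|]; split=> //.
by apply/real_carP; exists a.
Qed.

Lemma rval_itv (t : Itv) : 0 <= rval t /\ rval t <= 1.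
Proof. by apply/mem_itv; rewrite emb_rval; exact: valP. Qed.

Lemma rval_ge0 (t : Itv) : 0 <= rval t. Proof. exact: (rval_itv t).1. Qed.
Lemma rval_le1 (t : Itv) : rval t <= 1. Proof. exact: (rval_itv t).2. Qed.

Lemma rval_ex (a : Rm) : 0 <= a -> a <= 1 -> exists t, rval t = a.
Proof.
move=> a0 a1; have aI : emb a ∈ itv S by apply/mem_itv.
by exists (MkEl _ aI); apply: emb_inj; rewrite emb_rval.
Qed.

(** Graph of the retraction of the real line onto [0, 1]. Composition with [clamp] lets paths be
    given by real formulas without proofs that the values lie in the interval. *)
Definition clamped (a : Rm) (t : Itv) := (a <= 0 /\ rval t = 0) \/
  (0 <= a /\ a <= 1 /\ rval t = a) \/ (1 <= a /\ rval t = 1).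

Lemma clamp_ex a : exists t, clamped a t.
Proof.
rewrite /clamped; case: (lerP a 0) => a0.
  by have [||t rt] := @rval_ex 0; rewrite ?lexx ?ler01 //; exists t; left.
case: (lerP a 1) => a1.
  have [||t rt] := @rval_ex a; rewrite ?(ltW a0) //.
  by exists t; right; left; split=> //; exact: ltW.
have [||t rt] := @rval_ex 1; rewrite ?lexx ?ler01 //.
by exists t; right; right; split=> //; exact: ltW.
Qed.

Definition clamp a : Itv := sval (cid (clamp_ex a)).
Lemma clampP a : clamped a (clamp a).
Proof. by rewrite /clamp; case: cid. Qed.

Lemma clamp_eq a t : clamped a t -> t = clamp a.
Proof.
move=> H; apply: rval_inj; have := clampP a; move: H; rewrite /clamped.
by move=> [[? ->]|[[? [? ->]]|[? ->]]] [[? ->]|[[? [? ->]]|[? ->]]]; lra.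
Qed.

Lemma clampK t : clamp (rval t) = t.
Proof.
by symmetry; apply: clamp_eq; right; left; rewrite rval_ge0 rval_le1.
Qed.

End Interval.
#[global] Hint Resolve dfun_rval : def.

Section Clamp.
Local Open Scope ring_scope.
Context {M : structure} {zf : ZF M} {S : standard_sets M}.

Lemma dfun_clamp : dfun (clamp : Rm -> Itv).
Proof.
apply: (dfun_char (Q := clamped)); first by rewrite /clamped; def.
move=> a t; split=> [->|]; [exact: clampP | exact: clamp_eq].
Qed.

Definition I0 : Itv := clamp 0.
Definition I1 : Itv := clamp 1.
Lemma rval0 : rval I0 = 0. Proof. by case: (clampP 0) => [[]|[[_ []]|[]]] //; lra. Qed.
Lemma rval1 : rval I1 = 1. Proof. by case: (clampP 1) => [[]|[[_ []]|[]]] //; lra. Qed.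

Lemma clamp_le0 a : a <= 0 -> clamp a = I0.
Proof. by move=> H; symmetry; apply: clamp_eq; left; rewrite rval0. Qed.
Lemma clamp_ge1 a : 1 <= a -> clamp a = I1.
Proof. by move=> H; symmetry; apply: clamp_eq; right; right; rewrite rval1. Qed.
Lemma rval_clamp a : 0 <= a -> a <= 1 -> rval (clamp a) = a.
Proof. by case: (clampP a) => [[]|[[_ []]|[]]] // *; lra. Qed.

(** |a - b| < d as two linear inequalities, which suits [lra] and keeps the absolute value out of
    definability goals. *)
Definition close (a b d : Rm) := a - b < d /\ b - a < d.

Lemma close_clamp a b d : close a b d -> close (rval (clamp a)) (rval (clamp b)) d.
Proof.
move=> [H1 H2]; split; case: (clampP a) => [[? ->]|[[? [? ->]]|[? ->]]];
  case: (clampP b) => [[? ->]|[[? [? ->]]|[? ->]]]; lra.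
Qed.

Lemma close_refl a d : 0 < d -> close a a d.
Proof. by rewrite /close subrr. Qed.

Lemma close_le a b d e : close a b d -> d <= e -> close a b e.
Proof. by move=> [H1 H2] H; split; lra. Qed.

End Clamp.
#[global] Hint Resolve dfun_clamp : def.

Section Topologies.
Local Open Scope ring_scope.
Context {M : structure} {zf : ZF M} {S : standard_sets M}.

Lemma def_close : definable (fun p : Rm * Rm * Rm => close p.1.1 p.1.2 p.2).
Proof. by rewrite /close; def. Qed.
Local Hint Resolve def_close : def.

Lemma squareE : square S = car (Itv * Itv)%type.
Proof. by have [/is_prodE] := square_topP S. Qed.

Lemma min_ex (a b : Rm) : 0 < a -> 0 < b -> exists c, [/\ 0 < c, c <= a & c <= b].
Proof.
by move=> a0 b0; case: (lerP a b) => ab; [exists a|exists b]; split=> //; lra.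
Qed.

Lemma itv_open (U : M) : U ∈ itv_top S <-> U ⊆ itv S /\
  forall t : Itv, emb t ∈ U -> exists d, 0 < d /\
    forall s, close (rval s) (rval t) d -> emb s ∈ U.
Proof.
rewrite (itv_topP S U); split=> -[UI H]; split=> // t tU.
  have [a [b [/real_carP [a' <-] [/real_carP [b' <-] [+ [+ Hab]]]]]] := H _ tU.
  rewrite -emb_rval !ltRE => at_ tb.
  have [||d [d0 da db]] := @min_ex (rval t - a') (b' - rval t); try lra.
  exists d; split=> // s [H1 H2]; apply: Hab; first exact: valP.
    by rewrite -emb_rval ltRE; lra.
  by rewrite -emb_rval ltRE; lra.
have /El_carP [t' E] := UI _ tU; subst t.
have [d [d0 Hd]] := H _ tU.
have real (a : Rm) : emb a ∈ reals S by apply/real_carP; exists a.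
exists (emb (rval t' - d)), (emb (rval t' + d)); do 2 (split; first exact: real).
rewrite -[val t']emb_rval !ltRE; split; first lra; split; first lra.
move=> _ /El_carP [s <-]; rewrite -[val s]emb_rval !ltRE emb_rval => H1 H2.
by apply: Hd; split; lra.
Qed.

(* A junk radius [d <= 0] gives the whole square. *)
Definition box (d : Rm) (p q : Itv * Itv) :=
  0 < d -> close (rval q.1) (rval p.1) d /\ close (rval q.2) (rval p.2) d.

Lemma square_open (U : M) : U ∈ square_top S <-> U ⊆ square S /\
  forall p : Itv * Itv, emb p ∈ U -> exists d, 0 < d /\
    forall q, close (rval q.1) (rval p.1) d -> close (rval q.2) (rval p.2) d -> emb q ∈ U.
Proof.
rewrite squareE; have [_] := square_topP S; rewrite squareE => gen.
rewrite (generated_open (cyl := box) 1 _ _ _ gen); last first.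
- move=> d p.
  have ball (t : Itv) : exists W : El (itv_top S),
      forall s : Itv, emb s ∈ val W <-> (0 < d -> close (rval s) (rval t) d).
    have [W [WI HW]] := @subset_car _ _ Itv _
      (fun s => 0 < d -> close (rval s) (rval t) d) ltac:(by def).
    suff WT : W ∈ itv_top S by exists (MkEl W WT).
    apply/itv_open; split=> // s /HW Hs.
    case: (ltrP 0 d) => d0; last by exists 1; split=> [|s' _]; [lra|apply/HW; lra].
    have [H1 H2] := Hs d0.
    have [||e [e0 He1 He2]] := @min_ex (d - (rval s - rval t)) (d - (rval t - rval s)); try lra.
    exists e; split=> // s' [H3 H4]; apply/HW => _; split; lra.
  have [[W1 H1] [W2 H2]] := (ball p.1, ball p.2).
  have [topT [BT _]] := gen.
  have U1 : prod (val W1) (itv S) ∈ square_top S.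
    by apply: BT; left; exists (val W1); split; [exact: valP | exact: prodP].
  have U2 : prod (itv S) (val W2) ∈ square_top S.
    by apply: BT; right; exists (val W2); split; [exact: valP | exact: prodP].
  have [W HW] := inter_topology (MkEl _ U1) (MkEl _ U2) topT.
  have WE (q : Itv * Itv) : emb q ∈ val W <-> emb q.1 ∈ val W1 /\ emb q.2 ∈ val W2.
    rewrite HW /= !prodE; split.
      by move=> [[? [? [? _ /opair_inj [-> _]]]] [? [? [_ ? /opair_inj [_ ->]]]]].
    move=> [? ?]; split; exists (emb q.1), (emb q.2); split=> //; exact: valP.
  exists W; split=> [|q /WE [/H1 c1 /H2 c2] d0]; last by split; auto.
  by apply/WE; split; [apply/H1 | apply/H2] => d0; exact: close_refl.
- have comp U1 (V : El (itv_top S)) (p : Itv) :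
      U1 = val V -> emb p ∈ U1 -> exists d, 0 < d /\
      forall q : Itv, close (rval q) (rval p) d -> emb q ∈ U1.
    by move=> -> pV; have /itv_open [_] := valP V; apply.
  move=> V p [[W [WT /is_prodE ->]]|[W [WT /is_prodE ->]]];
    rewrite prodE => -[a [b [aW bI /opair_inj [? ?]]]]; subst.
    have [d [d0 Hd]] := comp W (MkEl W WT) p.1 erefl aW.
    exists d => q /(_ d0) [/Hd qW _]; apply/prodE.
    by exists (emb q.1), (emb q.2); split=> //; exact: valP.
  have [d [d0 Hd]] := comp W (MkEl W WT) p.2 erefl bI.
  exists d => q /(_ d0) [_ /Hd qW]; apply/prodE.
  by exists (emb q.1), (emb q.2); split=> //; exact: valP.
- have sub W : W ∈ itv_top S -> W ⊆ itv S by move/itv_open=> [].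
  by move=> V [[W [/sub WI /is_prodE ->]]|[W [/sub WI /is_prodE ->]]] z;
    rewrite !prodE => -[a [b [? ? ->]]]; exists a, b; split=> //; apply: WI.
- move=> d1 d2.
  case: (ltrP 0 d1) => H1; last by exists d2 => p q; rewrite /box; split=> //; lra.
  case: (ltrP 0 d2) => H2; last by exists d1 => p q; rewrite /box; split=> //; lra.
  have [d [d0 Hd1 Hd2]] := min_ex H1 H2; exists d => p q /(_ d0) [? ?].
  by split=> _; split; apply: close_le; eassumption.
- by move=> d p d0; split; exact: close_refl.
- by rewrite /box; def.
split=> -[UA H]; split=> // p /H [d Hd].
  case: (ltrP 0 d) => d0; last by exists 1; split=> [|q _ _]; [lra|apply: Hd; rewrite /box; lra].
  by exists d; split=> // q ? ?; apply: Hd.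
by exists d => q /(_ Hd.1) [? ?]; apply Hd.2.
Qed.

Definition agree (n : Nn) (a b : Can) :=
  forall k, k ≺ n -> (bit b k <-> bit a k).

Lemma def_agree : definable (fun p : Nn * Can * Can => agree p.1.1 p.1.2 p.2).
Proof. by rewrite /agree; def. Qed.
Local Hint Resolve def_agree : def.

Lemma cantor_open (U : M) : U ∈ cantor_top S <-> U ⊆ cantor S /\
  forall a : Can, emb a ∈ U -> exists n : Nn, forall b : Can,
    agree n a b -> emb b ∈ U.
Proof.
have gen := cantor_topP S.
have bitE (a : Can) (n : Nn) b : rel (val a) (val n) b <->
    (bit a n /\ b = val twoI) \/ (~ bit a n /\ b = val twoZ).
  have [f fa] := Can_FnP a; rewrite /bit -[emb a]fa -fa (apP f n twoI).
  rewrite relE; have /= H := apP f n; split=> [Hb|].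
    have /= [c [d [_ [/El_carP [b' <-] /is_opairE /opair_inj [_ E]]]]] :=
      (Fn_fun f).1 _ Hb; subst b.
    move/H: Hb => ->; case: (two_cases b') => ->; [right|by left].
    by split=> // E; case: two_neq.
  case=> -[E ->]; apply/H => //.
  by case: (two_cases (ap f n)) E => ->.
apply: (generated_open (A := Can) (cyl := agree) zeroN _ _ _ gen).
- exact: def_agree.
- by [].
- move=> n m; have [k [nk mk]] := maxN_ex n m; exists k => a b H; split=> j Hj;
  by apply: H; apply: lto_leo_trans Hj _.
- by move=> V [n [B [nw [B2 HV]]]] z /HV [].
- move=> V p [n [B [nw [B2 HV]]]] /HV [_ [i [Hi iB]]].
  pose n' : Nn := MkEl n nw; exists (succN n') => q Hq; apply/HV; split; first exact: valP.
  exists i; split=> //; apply/(bitE q n').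
  by rewrite (Hq n' (lto_succ n')); apply/(bitE p n').
(* A cylinder fixes finitely many digits in the sense of [M], so the subbasic sets are intersected
   one digit at a time by induction inside [M]. *)
move=> n a; move: n; have [topT [BT _]] := gen; apply: indN.
- by def.
- have [_ [_ [CT _]]] := topT; exists (MkEl _ CT); split; first exact: valP.
  by move=> q _ k /ltoN0.
move=> n [W [aW HW]].
have [V [VT HV]] : exists V, V ∈ cantor_top S /\
    forall q : Can, emb q ∈ V <-> (bit q n <-> bit a n).
  have [|V [VC HV]] := subset_car (P := fun q : Can => bit q n <-> bit a n).
    by def.
  have [|B [B2 HB]] := subset_car (P := fun i : Two =>
    (bit a n /\ i = twoI) \/ (~ bit a n /\ i = twoZ)); first by def.
  exists V; split=> //; apply: BT; exists (val n), B; split; first exact: valP.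
  split=> // f; split=> [fV|[fC [i [Hi iB]]]].
    split; first exact: VC.
    have /El_carP [q E] := VC _ fV; subst f; move/HV: fV => E.
    case: (pselect (bit a n)) => Ha; [exists (val twoI)|exists (val twoZ)];
      (split; first by apply/bitE; rewrite E; auto); apply/HB; auto.
  have /El_carP [q E] := fC; subst f; apply/HV.
  have /El_carP [i' E] := B2 _ iB; subst i.
  move/HB: iB; move/bitE: Hi => /= [[b1 /val_inj ->]|[b1 /val_inj ->]] [[b2 E]|[b2 E]] //.
    by case: two_neq.
  by case: two_neq.
have [W' HW'] := inter_topology W (MkEl _ VT) topT.
exists W'; split; first by apply/HW'; split=> //; apply/HV.
move=> q /HW' [/HW H1 /HV H2] k /leoE [/H1 //|-> //].
Qed.

End Topologies.
#[global] Hint Resolve def_close def_agree : def.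

(** * Continuous real functions on the square *)

Section ContinuousReal.
Local Open Scope ring_scope.
Context {M : structure} {zf : ZF M} {S : standard_sets M}.

(** Paths are covered as well, as functions that depend on the first coordinate only. *)
Definition contR (F : Itv * Itv -> Rm) := forall p e, 0 < e ->
  exists d, 0 < d /\ forall q, close (rval q.1) (rval p.1) d ->
    close (rval q.2) (rval p.2) d -> close (F q) (F p) e.

Lemma contR_fst : contR (fun p => rval p.1).
Proof. by move=> p e e0; exists e. Qed.

Lemma contR_snd : contR (fun p => rval p.2).
Proof. by move=> p e e0; exists e. Qed.

Lemma contR_cst c : contR (fun _ => c).
Proof. by move=> p e e0; exists e; split=> // *; exact: close_refl. Qed.

Lemma contR_clamp F : contR F -> contR (fun p => rval (clamp (F p))).
Proof.
move=> cF p e e0; have [d [d0 H]] := cF p e e0.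
by exists d; split=> // q ? ?; apply: close_clamp; apply: H.
Qed.

Lemma contR_opp F : contR F -> contR (fun p => - F p).
Proof.
move=> cF p e e0; have [d [d0 H]] := cF p e e0.
by exists d; split=> // q c1 c2; have [] := H q c1 c2; split; lra.
Qed.

Lemma contR2 F G p e1 e2 : contR F -> contR G -> 0 < e1 -> 0 < e2 ->
  exists d, 0 < d /\ forall q, close (rval q.1) (rval p.1) d ->
    close (rval q.2) (rval p.2) d -> close (F q) (F p) e1 /\ close (G q) (G p) e2.
Proof.
move=> cF cG e10 e20; have [d1 [d10 H1]] := cF p e1 e10.
have [d2 [d20 H2]] := cG p e2 e20.
have [d [d0 dd1 dd2]] := min_ex d10 d20.
exists d; split=> // q c1 c2; split.
  by apply: H1; [exact: close_le c1 _ | exact: close_le c2 _].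
by apply: H2; [exact: close_le c1 _ | exact: close_le c2 _].
Qed.

Lemma contR_add F G : contR F -> contR G -> contR (fun p => F p + G p).
Proof.
move=> cF cG p e e0; have e20 : 0 < e / 2 by lra.
have [d [d0 H]] := contR2 p cF cG e20 e20.
by exists d; split=> // q c1 c2; have [[? ?] [? ?]] := H q c1 c2; split; lra.
Qed.

Lemma contR_mul F G : contR F -> contR G -> contR (fun p => F p * G p).
Proof.
(* With F and G within h <= 1 of their values at p, the products differ by at most (|F p| + 1 + |G
   p|) h < K h <= e; the second unit in K gives strictness. *)
move=> cF cG p e e0; pose K := `|F p| + `|G p| + 2.
have K0 : 0 < K by rewrite /K; have := normr_ge0 (F p); have := normr_ge0 (G p); lra.
have eK0 : 0 < e / K by rewrite divr_gt0.
have [|h [h0 h1 hK]] := @min_ex _ _ _ 1 (e / K) _ eK0; first by lra.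
have [d [d0 H]] := contR2 p cF cG h0 h0.
have closeE a b c : close a b c <-> `|a - b| < c.
  rewrite /close ltr_norml; split=> [[? ?]|/andP[? ?]]; last by split; lra.
  by apply/andP; split; lra.
exists d; split=> // q c1 c2; have [/closeE HF /closeE HG] := H q c1 c2.
apply/closeE.
have -> : F q * G q - F p * G p = F q * (G q - G p) + (F q - F p) * G p by ring.
apply: le_lt_trans (ler_normD _ _) _; rewrite !normrM.
have Fq : `|F q| <= `|F p| + 1.
  have -> : F q = F p + (F q - F p) by ring.
  by apply: le_trans (ler_normD _ _) _; lra.
have E : h * K <= e by rewrite -ler_pdivlMr.
have := normr_ge0 (F q); have := normr_ge0 (G p); have := normr_ge0 (F p).
have := normr_ge0 (G q - G p); have := normr_ge0 (F q - F p).
rewrite /K in E; move: HF HG Fq E h0.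
move: `|F q - F p| `|G q - G p| `|F q| `|F p| `|G p| => u v w y z.
by move=> *; nra.
Qed.

End ContinuousReal.

(** * Homotopy *)

Section Continuity.
Local Open Scope ring_scope.
Context {M : structure} {zf : ZF M} {S : standard_sets M} {X T : M}.

Definition cont1 (f : Itv -> El X) := forall (V : El T) t, emb (f t) ∈ emb V ->
  exists d, 0 < d /\ forall s, close (rval s) (rval t) d -> emb (f s) ∈ emb V.

Definition cont2 (F : Itv * Itv -> El X) :=
  forall (V : El T) p, emb (F p) ∈ emb V ->
  exists d, 0 < d /\ forall q, close (rval q.1) (rval p.1) d ->
    close (rval q.2) (rval p.2) d -> emb (F q) ∈ emb V.

Lemma preimageE {A} {sA : small M A} (f : Fn A (El X)) (W V : M) :
  is_preimage W (val f) (car A) V <->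
  W ⊆ car A /\ forall a : A, emb a ∈ W <-> emb (ap f a) ∈ V.
Proof.
have relf a b : rel (val f) (emb a) b <-> emb (ap f a) = b.
  split=> [H|<-]; last exact/rel_ap.
  have /relE /(Fn_fun f).1 [? [? [_ [/El_carP [b' <-]]]]] := H.
  by move=> /is_opairE /opair_inj [_ E]; subst b; move/rel_ap: H => <-.
split=> [H|[WA H] a].
  split=> [a aW|a]; first exact: (iffLR (H a) aW).1.
  rewrite (H (emb a)); split=> [[_ [b [/relf <-]]]//|fV].
  by split; [exact: emb_car | exists (emb (ap f a)); rewrite relf].
split=> [aW|[aA [b [ab bV]]]]; last first.
  have [a' E] := iffLR (carP a) aA; subst a; move/relf: ab => E.
  by subst b; apply/H.
have /carP [a' E] := WA _ aW; subst a; split; first exact: emb_car.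
by exists (emb (ap f a')); split; [exact/relf | exact/H].
Qed.

Lemma continuous1E (f : Fn Itv (El X)) :
  continuous (itv S) (itv_top S) X T (val f) <-> cont1 (ap f).
Proof.
split=> [[_ H] V t tV|H]; last first.
  split; first exact: (Fn_fun f).
  move=> V W VT /(preimageE (A := Itv)) [WI HW]; apply/itv_open; split=> // t /HW tV.
  have [d [d0 Hd]] := H (MkEl V VT) t tV.
  by exists d; split=> // s /Hd; exact: (HW s).2.
have [|W [WI HW]] := subset_car (P := fun t => emb (ap f t) ∈ emb V); first by def.
have WT : W ∈ itv_top S by apply: (H _ _ (valP V)); apply/(preimageE (A := Itv)).
have /itv_open [_ /(_ t)] := WT; case; first exact/HW.
by move=> d [d0 Hd]; exists d; split=> // s /Hd /HW.
Qed.

Lemma continuous2E (f : Fn (Itv * Itv) (El X)) :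
  continuous (square S) (square_top S) X T (val f) <-> cont2 (ap f).
Proof.
split=> [[_ H] V t tV|H]; last first.
  split; first by rewrite squareE; exact: (Fn_fun f).
  move=> V W VT; rewrite squareE => /preimageE [WI HW].
  apply/square_open; split=> [|t /HW tV]; first by rewrite squareE.
  have [d [d0 Hd]] := H (MkEl V VT) t tV.
  by exists d; split=> // s c1 c2; apply/HW; apply: Hd.
have [|W [WI HW]] := subset_car (P := fun t => emb (ap f t) ∈ emb V); first by def.
have WT : W ∈ square_top S.
  by apply: (H _ _ (valP V)); rewrite squareE; apply/preimageE.
have /square_open [_ /(_ t)] := WT; case; first exact/HW.
by move=> d [d0 Hd]; exists d; split=> // s c1 c2; apply/HW; apply: Hd.
Qed.

Lemma cont2_comp F u v : cont2 F -> contR u -> contR v ->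
  cont2 (fun p => F (clamp (u p), clamp (v p))).
Proof.
move=> cF cu cv V p pV; have [e [e0 He]] := cF V _ pV.
have [d [d0 Hd]] := contR2 p cu cv e0 e0.
exists d; split=> // q c1 c2; have [? ?] := Hd q c1 c2.
by apply: He => /=; apply: close_clamp.
Qed.

Lemma cont2_comp1 f u : cont1 f -> contR u -> cont2 (fun p => f (clamp (u p))).
Proof.
move=> cf cu V p pV; have [e [e0 He]] := cf V _ pV.
have [d [d0 Hd]] := cu p e e0; exists d; split=> // q c1 c2.
by apply: He; apply: close_clamp; apply: Hd.
Qed.

Lemma cont1_of2 f : cont2 (fun p => f p.1) -> cont1 f.
Proof.
move=> cf V t tV; have [d [d0 Hd]] := cf V (t, t) tV.
by exists d; split=> // s c; apply: (Hd (s, t)) => //; exact: close_refl.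
Qed.

(** Replaces the pasting lemma: case distinctions below are arranged so that both formulas agree on
    an overlap with interior. *)
Lemma cont2_local F :
  (forall p, exists G, cont2 G /\ exists d, 0 < d /\ forall q,
     close (rval q.1) (rval p.1) d -> close (rval q.2) (rval p.2) d -> F q = G q) ->
  cont2 F.
Proof.
move=> H V p pV; have [G [cG [d1 [d10 E]]]] := H p.
rewrite E in pV; [|exact: close_refl|exact: close_refl].
have [d2 [d20 Hd]] := cG V p pV; have [d [d0 dd1 dd2]] := min_ex d10 d20.
exists d; split=> // q c1 c2; rewrite E.
- by apply: Hd; [exact: close_le c1 _ | exact: close_le c2 _].
- exact: close_le c1 _.
- exact: close_le c2 _.
Qed.

Context {x : El X}.

Definition based_loop (f : Fn Itv (El X)) :=
  cont1 (ap f) /\ ap f I0 = x /\ ap f I1 = x.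

Definition rel_homotopic (f g : Fn Itv (El X)) := exists H : Fn (Itv * Itv) (El X),
  cont2 (ap H) /\
  ((forall t, ap H (t, I0) = ap f t) /\ (forall t, ap H (t, I1) = ap g t)) /\
  forall s, ap H (I0, s) = x /\ ap H (I1, s) = x.

Lemma val_I0 : val I0 = rzero S.
Proof. by rewrite -emb0 -rval0 emb_rval. Qed.
Lemma val_I1 : val I1 = rone S.
Proof. by rewrite -emb1 -rval1 emb_rval. Qed.

Lemma loop_Fn f : loop S X T (val x) f <->
  exists F : Fn Itv (El X), val F = f /\ based_loop F.
Proof.
rewrite /loop -val_I0 -val_I1; split.
  move=> [cf [f0 f1]].
  have hf : is_fun f (car Itv) (car (El X)) by case: cf.
  have [F E] := iffLR (FnP f) hf; subst f.
  by exists F; split=> //; split; [exact/continuous1E | split; exact/(rel_ap F)].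
by move=> [F [<- [cF [F0 F1]]]]; split; [exact/continuous1E | split; exact/(rel_ap F)].
Qed.

Lemma rel2_ap (H : Fn (Itv * Itv) (El X)) (s t : Itv) y :
  rel2 (val H) (val s) (val t) (val y) <-> ap H (s, t) = y.
Proof.
rewrite /rel2; split=> [[p [/is_opairE ->]]|E]; first by move/(rel_ap H (s, t)).
by exists (emb (s, t)); rewrite is_opairE; split=> //; apply/(rel_ap H (s, t)).
Qed.

Lemma homotopic_Fn (f g : Fn Itv (El X)) :
  homotopic S X T (val x) (val f) (val g) <-> rel_homotopic f g.
Proof.
rewrite /homotopic -val_I0 -val_I1; split.
  move=> [h [ch [h0 [h1 hs]]]].
  have hF : is_fun h (car (Itv * Itv)%type) (car (El X)).
    by rewrite -squareE; case: ch.
  have [H E] := iffLR (FnP h) hF; subst h.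
  exists H; split; first exact/continuous2E.
  split; first split=> t.
  - by apply/rel2_ap; apply: h0; [exact: valP | exact/(rel_ap f)].
  - by apply/rel2_ap; apply: h1; [exact: valP | exact/(rel_ap g)].
  by move=> s; have [? ?] := hs _ (valP s); split; apply/rel2_ap.
move=> [H [cH [[H0 H1] Hs]]]; exists (val H); split; first exact/continuous2E.
have aux (h : Fn Itv (El X)) t y : t ∈ itv S -> rel (val h) t y ->
    exists t' : Itv, val t' = t /\ val (ap h t') = y.
  move=> /El_carP [t' <-] Hr; exists t'; split=> //.
  have /relE /(Fn_fun h).1 [? [? [_ [/El_carP [y' <-]]]]] := Hr.
  by move=> /is_opairE /opair_inj [_ E]; subst y; move/(rel_ap h): Hr => ->.
split=> [t y /aux tI /tI [t' [<- <-]]|]; first by apply/rel2_ap.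
split=> [t y /aux tI /tI [t' [<- <-]]|]; first by apply/rel2_ap.
move=> s /El_carP [s' <-]; have [? ?] := Hs s'.
by split; apply/(rel2_ap H).
Qed.

Lemma Hom_intro (K : Itv * Itv -> El X) f g : dfun K -> cont2 K ->
  (forall t, K (t, I0) = ap f t) -> (forall t, K (t, I1) = ap g t) ->
  (forall s, K (I0, s) = x /\ K (I1, s) = x) -> rel_homotopic f g.
Proof.
move=> dK cK K0 K1 Ks; exists (lam dK).
have -> : ap (lam dK) = K by apply: funext => p; exact: lamE.
by [].
Qed.

Lemma Hom_refl f : based_loop f -> rel_homotopic f f.
Proof.
move=> [cf [f0 f1]]; apply: (@Hom_intro (fun p => ap f (clamp (rval p.1)))).
- by def.
- by apply: cont2_comp1 => //; exact: contR_fst.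
- by move=> t; rewrite clampK.
- by move=> t; rewrite clampK.
- by move=> s; rewrite !clampK.
Qed.

Lemma contR_sub u v : contR u -> contR v -> contR (fun p => u p - v p).
Proof. by move=> cu cv; apply: contR_add => //; exact: contR_opp. Qed.

Lemma Hom_sym f g : rel_homotopic f g -> rel_homotopic g f.
Proof.
move=> [H [cH [[H0 H1] Hs]]].
apply: (@Hom_intro (fun p => ap H (clamp (rval p.1), clamp (1 - rval p.2)))).
- by def.
- apply: cont2_comp => //; first exact: contR_fst.
  by apply: contR_sub; [exact: contR_cst | exact: contR_snd].
- by move=> t; rewrite clampK rval0 subr0 -/I1.
- by move=> t; rewrite clampK rval1 subrr -/I0.
- by move=> s; rewrite !clampK; have [] := Hs (clamp (1 - rval s)).
Qed.

Lemma Hom_trans g f h : rel_homotopic f g -> rel_homotopic g h -> rel_homotopic f h.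
Proof.
move=> [H [cH [[H0 H1] Hs]]] [K [cK [[K0 K1] Ks]]].
pose (F1 := fun p : Itv * Itv => ap H (clamp (rval p.1), clamp (3 * rval p.2))).
pose (F2 := fun p : Itv * Itv => ap K (clamp (rval p.1), clamp (3 * rval p.2 - 2))).
have c1 : cont2 F1.
  apply: cont2_comp => //; first exact: contR_fst.
  by apply: contR_mul; [exact: contR_cst | exact: contR_snd].
have c2 : cont2 F2.
  apply: cont2_comp => //; first exact: contR_fst.
  apply: contR_sub; last exact: contR_cst.
  by apply: contR_mul; [exact: contR_cst | exact: contR_snd].
(* Between s = 1/3 and s = 2/3 both formulas give g. *)
have E1 p : 3 * rval p.2 <= 2 -> 1 <= 3 * rval p.2 -> F1 p = F2 p.
  move=> le2 ge1; rewrite /F1 /F2 !clampK (clamp_ge1 ge1) clamp_le0; last by lra.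
  by rewrite H1 K0.
(* The switch at s = 1/2 has distance 1/6 from both ends of the overlap, whence the radius below. *)
pose (F := fun p : Itv * Itv => if 3 * rval p.2 <= 3 / 2 then F1 p else F2 p).
apply: (@Hom_intro F).
- by rewrite /F /F1 /F2; def.
- apply: cont2_local => p; case: (lerP (3 * rval p.2) (3 / 2)) => Hp.
    exists F1; split=> //; exists (1/6); split; first by lra.
    move=> q _ [? ?]; rewrite /F; case: lerP => // ?; symmetry; apply: E1; lra.
  exists F2; split=> //; exists (1/6); split; first by lra.
  move=> q _ [? ?]; rewrite /F; case: lerP => // ?; apply: E1; lra.
- move=> t; rewrite /F /F1 /= rval0 mulr0 ifT; last by lra.
  by rewrite clampK -/I0.
- move=> t; rewrite /F /F2 /= rval1 mulr1 ifF; last by apply/negP; lra.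
  by rewrite clampK clamp_ge1 ?K1 //; lra.
- move=> s; rewrite /F /F1 /F2 /= !clampK.
  have [? ?] := Hs (clamp (3 * rval s)); have [? ?] := Ks (clamp (3 * rval s - 2)).
  by case: ifP.
Qed.

(* The straight-line homotopy in the square between the paths (p1, p2) and
   (q1, q2), composed with F. *)
Lemma Hom_straight (F : Fn (Itv * Itv) (El X)) (p1 p2 q1 q2 : Itv -> Rm) f g :
  cont2 (ap F) -> dfun p1 -> dfun p2 -> dfun q1 -> dfun q2 ->
  contR (fun z => p1 z.1) -> contR (fun z => p2 z.1) ->
  contR (fun z => q1 z.1) -> contR (fun z => q2 z.1) ->
  (forall t, ap f t = ap F (clamp (p1 t), clamp (p2 t))) ->
  (forall t, ap g t = ap F (clamp (q1 t), clamp (q2 t))) ->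
  p1 I0 = q1 I0 -> p2 I0 = q2 I0 -> p1 I1 = q1 I1 -> p2 I1 = q2 I1 ->
  ap f I0 = x -> ap f I1 = x -> rel_homotopic f g.
Proof.
move=> cF dp1 dp2 dq1 dq2 cp1 cp2 cq1 cq2 Ef Eg e1 e2 e3 e4 f0 f1.
pose (L := fun (p q : Itv -> Rm) (z : Itv * Itv) =>
  (1 - rval z.2) * p z.1 + rval z.2 * q z.1).
have cL p q : contR (fun z => p z.1) -> contR (fun z => q z.1) -> contR (L p q).
  move=> cp cq; apply: contR_add; apply: contR_mul => //; last exact: contR_snd.
  by apply: contR_sub; [exact: contR_cst | exact: contR_snd].
have L0 p q t : L p q (t, I0) = p t by rewrite /L /= rval0; lra.
have L1 p q t : L p q (t, I1) = q t by rewrite /L /= rval1; lra.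
have Lc p q t s : p t = q t -> L p q (t, s) = p t by rewrite /L /= => <-; lra.
apply: (@Hom_intro (fun z => ap F (clamp (L p1 q1 z), clamp (L p2 q2 z)))).
- by rewrite /L; def.
- by apply: cont2_comp => //; exact: cL.
- by move=> t; rewrite !L0.
- by move=> t; rewrite !L1.
- by move=> s; rewrite !Lc // -!Ef.
Qed.

End Continuity.

(** * The geometric sequence of interval lengths *)

Section Halving.
Local Open Scope ring_scope.
Context {M : structure} {zf : ZF M} {S : standard_sets M}.

Definition halving (e : Nn -> Rm) :=
  forall n, [/\ 0 < e n, 2 * e n <= 1 & 2 * e (succN n) = e n].

Lemma halving_ex : DC S -> exists e : Fn Nn Rm, halving (ap e).
Proof.
(* The default 1/4 makes [R] total and is itself admissible, so a single step from any value leads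
   into the range 0 < a, 2a <= 1. *)
move=> dc; pose (R := fun a b : Rm =>
  ((0 < a /\ 2 * a <= 1) /\ 2 * b = a) \/ (~ (0 < a /\ 2 * a <= 1) /\ b = 1 / 4)).
have [||e He] := dependent_choice (R := R) dc (0 : Rm).
- by rewrite /R; def.
- move=> a; case: (pselect (0 < a /\ 2 * a <= 1)) => H; last by exists (1/4); right.
  by exists (a / 2); left; split=> //; lra.
(* The first value is arbitrary; the sequence is as required from the second
   one on. *)
have ds : dfun (fun n => ap e (succN n)) by def.
exists (lam ds) => n; rewrite !lamE.
have /andP : (0 < ap e (succN n)) && (2 * ap e (succN n) <= 1).
  by case: (He n) => [[[? ?] ?]|[_ ->]]; apply/andP; split; lra.
by move=> [? ?]; case: (He (succN n)) => [[_ ->]|[[]]].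
Qed.

Lemma halving_mono (e : Fn Nn Rm) : halving (ap e) ->
  forall n m, n ≼ m -> ap e m <= ap e n.
Proof.
move=> He; apply: mono_leo; [by def|by []|].
by move=> n m H; have [_ _ E] := He m; have [? _ _] := He (succN m); lra.
Qed.

(** This makes the intervals ]e_n, 2 e_n[ pairwise disjoint. *)
Lemma halving_lt (e : Fn Nn Rm) : halving (ap e) ->
  forall n m, n ≺ m -> 2 * ap e m <= ap e n.
Proof.
move=> He n m nm.
have H : ap e m <= ap e (succN n) by apply: halving_mono => //; exact: succ_leo.
by have [_ _ <-] := He n; lra.
Qed.

End Halving.

(** * Contracting a loop pasted into a constant stretch *)

Section Paste.
Local Open Scope ring_scope.
Context {M : structure} {zf : ZF M} {S : standard_sets M}.

Definition cl (y : Rm) : Rm := rval (clamp y).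

Lemma dfun_cl : dfun cl.
Proof. by rewrite /cl; def. Qed.
Local Hint Resolve dfun_cl : def.

Definition clspec (y z : Rm) :=
  (y <= 0 /\ z = 0) \/ (0 <= y /\ y <= 1 /\ z = y) \/ (1 <= y /\ z = 1).

Lemma clP y : clspec y (cl y). Proof. exact: clampP. Qed.
Lemma cl0 y z : clspec y z -> y <= 0 -> z = 0.
Proof. by move=> [[_ //]|[[? [? ->]]|[? ->]]] ?; lra. Qed.
Lemma cl1 y z : clspec y z -> 1 <= y -> z = 1.
Proof. by move=> [[? ->]|[[? [? ->]]|[? ->]]] ?; lra. Qed.
Lemma clid y z : clspec y z -> 0 <= y -> y <= 1 -> z = y.
Proof. by move=> [[? ->]|[[? [? ->]]|[? ->]]] ? ?; lra. Qed.

(* A path (q1, q2) in the square, at time y of [0, 5]: along the bottom from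
   (a, 0) to (0, 0), then through (0, 1), (1, 1) and (1, 0) to (b, 0). *)
Definition detour1 (a b y : Rm) := a * cl (1 - y) + cl (y - 2) - (1 - b) * cl (y - 4).
Definition detour2 (y : Rm) := cl (y - 1) - cl (y - 3).

(** The three alternatives are the places where a homotopy H from F to G satisfies H (s, t) = G s:
    the bottom outside ]a, b[, where F = G; the top, where H is G; the two sides, where all values
    are the base point. *)
Lemma detour_cases (a b y : Rm) : 0 <= a -> a <= 1 -> 0 <= b -> b <= 1 -> 0 <= y -> y <= 5 ->
  let q1 := detour1 a b y in let q2 := detour2 y in
  (0 <= q1 /\ q1 <= 1) /\ (0 <= q2 /\ q2 <= 1) /\
  [\/ (q1 <= a \/ b <= q1) /\ q2 = 0, q2 = 1 | q1 = 0 \/ q1 = 1].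
Proof.
move=> a0 a1 b0 b1 y0 y5; rewrite /detour1 /detour2 /=.
have := clP (y - 3); have := clP (y - 1); have := clP (y - 4).
have := clP (y - 2); have := clP (1 - y).
(* Once the clamped terms are variables, on each unit of time every one of them is a constant or
   affine in [y]. *)
generalize (cl (1 - y)) (cl (y - 2)) (cl (y - 4)) (cl (y - 1)) (cl (y - 3)).
move=> z1 z2 z4 z5 z6 h1 h2 h4 h5 h6.
case: (lerP y 1) => y1.
  have -> : z1 = 1 - y by apply: (clid h1); lra.
  have -> : z2 = 0 by apply: (cl0 h2); lra.
  have -> : z4 = 0 by apply: (cl0 h4); lra.
  have -> : z5 = 0 by apply: (cl0 h5); lra.
  have -> : z6 = 0 by apply: (cl0 h6); lra.
  by split; [split; nra | split; [split; lra | constructor 1; split; [left; nra | lra]]].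
case: (lerP y 2) => y2.
  have -> : z1 = 0 by apply: (cl0 h1); lra.
  have -> : z2 = 0 by apply: (cl0 h2); lra.
  have -> : z4 = 0 by apply: (cl0 h4); lra.
  have -> : z5 = y - 1 by apply: (clid h5); lra.
  have -> : z6 = 0 by apply: (cl0 h6); lra.
  by split; [split; lra | split; [split; lra | constructor 3; left; lra]].
case: (lerP y 3) => y3.
  have -> : z1 = 0 by apply: (cl0 h1); lra.
  have -> : z2 = y - 2 by apply: (clid h2); lra.
  have -> : z4 = 0 by apply: (cl0 h4); lra.
  have -> : z5 = 1 by apply: (cl1 h5); lra.
  have -> : z6 = 0 by apply: (cl0 h6); lra.
  by split; [split; lra | split; [split; lra | constructor 2; lra]].
case: (lerP y 4) => y4.
  have -> : z1 = 0 by apply: (cl0 h1); lra.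
  have -> : z2 = 1 by apply: (cl1 h2); lra.
  have -> : z4 = 0 by apply: (cl0 h4); lra.
  have -> : z5 = 1 by apply: (cl1 h5); lra.
  have -> : z6 = y - 3 by apply: (clid h6); lra.
  by split; [split; lra | split; [split; lra | constructor 3; right; lra]].
have -> : z1 = 0 by apply: (cl0 h1); lra.
have -> : z2 = 1 by apply: (cl1 h2); lra.
have -> : z4 = y - 4 by apply: (clid h4); lra.
have -> : z5 = 1 by apply: (cl1 h5); lra.
have -> : z6 = 1 by apply: (cl1 h6); lra.
by split; [split; nra | split; [split; lra | constructor 1; split; [right; nra | lra]]].
Qed.

Lemma detour_start (a b y : Rm) : y = 0 -> detour1 a b y = a /\ detour2 y = 0.
Proof.
rewrite /detour1 /detour2 => y0.
have := clP (y - 3); have := clP (y - 1); have := clP (y - 4).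
have := clP (y - 2); have := clP (1 - y).
generalize (cl (1 - y)) (cl (y - 2)) (cl (y - 4)) (cl (y - 1)) (cl (y - 3)).
move=> z1 z2 z4 z5 z6 h1 h2 h4 h5 h6.
have -> : z1 = 1 by apply: (cl1 h1); lra.
have -> : z2 = 0 by apply: (cl0 h2); lra.
have -> : z4 = 0 by apply: (cl0 h4); lra.
have -> : z5 = 0 by apply: (cl0 h5); lra.
have -> : z6 = 0 by apply: (cl0 h6); lra.
by split; lra.
Qed.

Lemma detour_end (a b y : Rm) : y = 5 -> detour1 a b y = b /\ detour2 y = 0.
Proof.
rewrite /detour1 /detour2 => y0.
have := clP (y - 3); have := clP (y - 1); have := clP (y - 4).
have := clP (y - 2); have := clP (1 - y).
generalize (cl (1 - y)) (cl (y - 2)) (cl (y - 4)) (cl (y - 1)) (cl (y - 3)).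
move=> z1 z2 z4 z5 z6 h1 h2 h4 h5 h6.
have -> : z1 = 0 by apply: (cl0 h1); lra.
have -> : z2 = 1 by apply: (cl1 h2); lra.
have -> : z4 = 1 by apply: (cl1 h4); lra.
have -> : z5 = 1 by apply: (cl1 h5); lra.
have -> : z6 = 1 by apply: (cl1 h6); lra.
by split; lra.
Qed.

Lemma contR_cl u : contR u -> contR (fun z => cl (u z)).
Proof. exact: contR_clamp. Qed.

Lemma detour_ex (a b : Rm) : 0 <= a -> a <= 1 -> 0 <= b -> b <= 1 ->
  exists q1 q2 : Itv -> Rm, (dfun q1 /\ dfun q2) /\
    (contR (fun z => q1 z.1) /\ contR (fun z => q2 z.1)) /\
    (q1 I0 = a /\ q2 I0 = 0 /\ q1 I1 = b /\ q2 I1 = 0) /\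
    forall u, (0 <= q1 u /\ q1 u <= 1) /\ (0 <= q2 u /\ q2 u <= 1) /\
      [\/ (q1 u <= a \/ b <= q1 u) /\ q2 u = 0, q2 u = 1 | q1 u = 0 \/ q1 u = 1].
Proof.
move=> a0 a1 b0 b1.
exists (fun u => detour1 a b (5 * rval u)), (fun u => detour2 (5 * rval u)).
have ck := @contR_cst M zf S.
have c5 : contR (fun z : Itv * Itv => 5 * rval z.1) by exact: (contR_mul (ck _) contR_fst).
have cB v : contR (fun z : Itv * Itv => cl (5 * rval z.1 - v)).
  exact: (contR_cl (contR_sub c5 (ck _))).
split; first by rewrite /detour1 /detour2; split; def.
split.
  split; last exact: (contR_sub (cB _) (cB _)).
  exact: (contR_sub (contR_add (contR_mul (ck _) (contR_cl (contR_sub (ck _) c5)))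
    (cB _)) (contR_mul (ck _) (cB _))).
split; last first.
  move=> u; have h0 : 0 <= rval u by exact: rval_ge0.
  have h1 : rval u <= 1 by exact: rval_le1.
  by apply: detour_cases => //; lra.
have E0 : 5 * rval I0 = 0 by rewrite rval0 mulr0.
have E1 : 5 * rval I1 = 5 by rewrite rval1 mulr1.
have [-> ->] := detour_start a b E0; have [-> ->] := detour_end a b E1.
by [].
Qed.

End Paste.

Section Paste.
Local Open Scope ring_scope.
Context {M : structure} {zf : ZF M} {S : standard_sets M} {X T : M} {x : El X}.

Local Notation Loop := (based_loop (T := T) (x := x)).
Local Notation Hom := (rel_homotopic (T := T) (x := x)).

(** The affine map with 5e/4 to 0 and 7e/4 to 1. After clamping it is constant on the outer quarters
    of [e, 2e], so a pasted loop already rests at the base point near both ends. *)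
Definition stretch (e t : Rm) : Rm := 2 * (t / e) - 5 / 2.

(* Between a = 5e/4 and b = 7e/4 the loop F runs through f, elsewhere it equals
   G, and G is constant on [a, b].  In the square that is the domain of a
   homotopy H from F to G, the segment from (a, 0) to (b, 0) is homotopic to the
   path that goes back to (0, 0) and then through (0, 1), (1, 1) and (1, 0) to
   (b, 0).  On the latter H (s, t) = G s, so H maps it to G composed with a path
   from a to b in [0, 1]. *)
Lemma nullhomotopic_of_paste (f F G k : Fn Itv (El X)) (e : Rm) :
  0 < e -> 2 * e <= 1 -> Loop f -> Loop G ->
  (forall t, e < rval t -> rval t < 2 * e ->
     ap F t = ap f (clamp (stretch e (rval t))) /\ ap G t = x) ->
  (forall t, rval t <= e \/ 2 * e <= rval t -> ap F t = ap G t) ->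
  (forall t, ap k t = x) ->
  Hom F G -> Hom f k.
Proof.
move=> e0 e1 [cf [f0 f1]] [cG [G0 G1]] Fin Fout kx [H [cH [[H0 H1] Hs]]].
have [a Ea] : exists a, a = 5 / 4 * e by eexists.
have [b Eb] : exists b, b = 7 / 4 * e by eexists.
(* The segment from [a] to [b] at constant speed, as b - a = e/2. *)
pose (p := fun u : Itv => a + rval u * (e / 2)).
have [||||q1 [q2 [[dq1 dq2] [[cq1 cq2] [[q10 [q20 [q11 q21]]] Hq]]]]] :=
  detour_ex (a := a) (b := b); try lra.
have ck := @contR_cst M zf S.
have cp : contR (fun z => p z.1).
  exact: (contR_add (ck _) (contR_mul contR_fst (ck _))).
have dp : dfun p by rewrite /p; def.
have p0 : p I0 = a.
  rewrite /p.
  rewrite rval0.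
  rewrite mul0r.
  by rewrite addr0.
have p1 : p I1 = b by rewrite /p rval1; lra.
have ru u : 0 <= rval u /\ rval u <= 1 by split; [exact: rval_ge0 | exact: rval_le1].
have pI u : e < p u /\ p u < 2 * e.
  have [? ?] := ru u; have ? : 0 <= rval u * e by rewrite mulr_ge0 // ltW.
  have ? : rval u * e <= e by rewrite ler_piMl // ltW.
  by rewrite /p; split; lra.
have rp u : rval (clamp (p u)) = p u.
  by have [? ?] := pI u; apply: rval_clamp; lra.
have eN0 : e != 0 by rewrite gt_eqF.
(* Along the segment the reparametrization cancels: [stretch e (p u)] is [rval u]. *)
have Hf u : ap f u = ap H (clamp (p u), clamp 0).
  have [h1 h2] := pI u; rewrite -rp in h1; rewrite -rp in h2.
  rewrite -/I0 H0 (Fin _ h1 h2).1 -[in LHS](clampK u); congr (ap f (clamp _)).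
  rewrite rp /stretch /p Ea.
  have -> : (5 / 4 * e + rval u * (e / 2)) / e = 5 / 4 + rval u / 2 by field.
  by lra.
(* In the margins ]e, a] and [b, 2e[ the argument of [f] is clamped to an end point, so both loops
   are at [x]. *)
have FG t : rval t <= a \/ b <= rval t -> ap F t = ap G t.
  move=> Ht; case: (lerP (rval t) e) => h1; first by apply: Fout; left.
  case: (lerP (2 * e) (rval t)) => h2; first by apply: Fout; right.
  have [-> ->] := Fin t h1 h2.
  case: Ht => Ht; rewrite /stretch.
    rewrite clamp_le0 //; suff : rval t / e <= 5 / 4 by lra.
    by rewrite ler_pdivrMr -?Ea.
  rewrite clamp_ge1 //; suff : 7 / 4 <= rval t / e by lra.
  by rewrite ler_pdivlMr -?Eb.
have HG u : ap H (clamp (q1 u), clamp (q2 u)) = ap G (clamp (q1 u)).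
  have [[? ?] [[? ?] [[Hq1 ->]|->|Hq1]]] := Hq u.
  - by rewrite -/I0 H0 FG // rval_clamp.
  - by rewrite -/I1 H1.
  - by case: Hq1 => ->; [have [-> _] := Hs (clamp (q2 u)) |
      have [_ ->] := Hs (clamp (q2 u))].
have Gp u : ap G (clamp (p u)) = x.
  by have [h1 h2] := pI u; rewrite -rp in h1; rewrite -rp in h2;
    exact: (Fin _ h1 h2).2.
have dg : dfun (fun u => ap G (clamp (q1 u))) by def.
have dG1 : dfun (fun z : Itv * Itv => ap G (clamp (rval z.1))) by def.
have d0 : dfun (fun _ : Itv => 0 : Rm) by def.
have c0 : contR (fun z : Itv * Itv => 0) by exact: ck.
apply: (Hom_trans (g := lam dg)).
  apply: (Hom_straight (F := H) cH dp d0 dq1 dq2 cp c0 cq1 cq2) => //.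
  - by move=> u; rewrite lamE HG.
  - by rewrite p0.
  - by rewrite p1.
(* It remains to deform the path [q1] linearly within [0, 1] into the segment [p], along which G is
   [x]. For this G is viewed as a function on the square that ignores the second coordinate. *)
apply: (Hom_straight (F := lam dG1) _ dq1 d0 dp d0 cq1 c0 cp c0) => //.
- have -> : ap (lam dG1) = fun z => ap G (clamp (rval z.1)).
    by apply: funext => z; exact: lamE.
  by apply: cont2_comp1 => //; exact: contR_fst.
- by move=> u; rewrite !lamE clampK.
- by move=> u; rewrite !lamE clampK kx Gp.
- by rewrite p0.
- by rewrite p1.
- by rewrite lamE q10 -p0 Gp.
- by rewrite lamE q11 -p1 Gp.
Qed.

End Paste.

(** * The loops F_a *)

Section Family.
Local Open Scope ring_scope.
Context {M : structure} {zf : ZF M} {S : standard_sets M} {X T : M} {x : El X}.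

Local Notation Loop := (based_loop (T := T) (x := x)).
Local Notation Hom := (rel_homotopic (T := T) (x := x)).

Variables (f : Fn Nn (Fn Itv (El X))) (e : Fn Nn Rm).
Hypothesis f_loop : forall n, Loop (ap f n).
Hypothesis f_lim : forall V : El T, emb x ∈ emb V ->
  exists n, forall m, n ≼ m -> forall t, emb (ap (ap f m) t) ∈ emb V.
Hypothesis e_halving : halving (ap e).

Definition inO (n : Nn) (t : Itv) := ap e n < rval t /\ rval t < 2 * ap e n.
Definition piece (n : Nn) (t : Itv) := ap (ap f n) (clamp (stretch (ap e n) (rval t))).

Lemma def_inO : definable (fun p : Nn * Itv => inO p.1 p.2).
Proof. by rewrite /inO; def. Qed.
Lemma dfun_piece : dfun (fun p : Nn * Itv => piece p.1 p.2).
Proof. by rewrite /piece /stretch; def. Qed.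
Local Hint Resolve def_inO dfun_piece : def.

Lemma inO_uniq n m t : inO n t -> inO m t -> n = m.
Proof.
move=> [h1 h2] [h3 h4].
have aux i j : i ≺ j -> ap e i < rval t -> rval t < 2 * ap e j -> False.
  by move=> /(halving_lt e_halving) *; lra.
case: (lto_total n m) => [nm|[//|mn]]; first by case: (aux _ _ nm h1 h4).
by case: (aux _ _ mn h3 h2).
Qed.

(** A definable condition that determines [y], since the intervals are disjoint; this puts the whole
    family of loops into [M]. *)
Definition famspec (a : Can) (t : Itv) (y : El X) :=
  (exists n, bit a n /\ (inO n t /\ y = piece n t)) \/
  (~ (exists n, bit a n /\ inO n t) /\ y = x).

Lemma fam_ex a t : exists y, famspec a t y.
Proof.
case: (pselect (exists n, bit a n /\ inO n t)) => [[n [an nt]]|H].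
  by exists (piece n t); left; exists n.
by exists x; right.
Qed.

Definition fam a t : El X := sval (cid (fam_ex a t)).
Lemma famP a t : famspec a t (fam a t).
Proof. exact: (svalP (cid (fam_ex a t))). Qed.

Lemma fam_in a t n : bit a n -> inO n t -> fam a t = piece n t.
Proof.
move=> an nt; case: (famP a t) => [[m [am [mt ->]]]|[[]]]; last by exists n.
by rewrite (inO_uniq nt mt).
Qed.

Lemma fam_out a t : (forall n, bit a n -> ~ inO n t) -> fam a t = x.
Proof. by move=> H; case: (famP a t) => [[m [am [mt _]]]|[//]]; case: (H m). Qed.

Lemma dfun_fam : dfun (fun p : Can * Itv => fam p.1 p.2).
Proof.
apply: (dfun_char (Q := fun p y => famspec p.1 p.2 y)); first by rewrite /famspec; def.
move=> [a t] y /=; split=> [->|]; first exact: famP.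
case=> [[n [an [nt ->]]]|[H ->]]; first by rewrite (fam_in an nt).
by rewrite fam_out // => n an nt; apply: H; exists n.
Qed.
Local Hint Resolve dfun_fam : def.

Lemma fam_dfun a : dfun (fam a). Proof. by def. Qed.

Definition famF a : Fn Itv (El X) := lam (fam_dfun a).
Lemma famFE a t : ap (famF a) t = fam a t. Proof. exact: lamE. Qed.

Lemma dfun_famF : dfun famF.
Proof.
apply: (dfun_char (Q := fun a F => forall t, ap F t = fam a t)); first by def.
move=> a F; split=> [-> t|H]; first exact: famFE.
by apply: Fn_ext => t; rewrite H famFE.
Qed.

Lemma e_gt0 n : 0 < ap e n. Proof. by have [] := e_halving n. Qed.

Lemma cont_piece n : cont1 (T := T) (piece n).
Proof.
have [cf _] := f_loop n; apply: cont1_of2; apply: cont2_comp1 => //.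
apply: contR_sub; last exact: contR_cst.
apply: contR_mul; first exact: contR_cst.
by apply: contR_mul; [exact: contR_fst | exact: contR_cst].
Qed.

Lemma piece_edge n s : 5 * rval s <= 6 * ap e n \/ 9 * ap e n <= 5 * rval s ->
  piece n s = x.
Proof.
have [_ [f0 f1]] := f_loop n; have en := e_gt0 n; rewrite /piece /stretch.
case=> H.
  rewrite clamp_le0 //; suff : rval s / ap e n <= 6 / 5 by lra.
  by rewrite ler_pdivrMr //; lra.
rewrite clamp_ge1 //; suff : 9 / 5 <= rval s / ap e n by lra.
by rewrite ler_pdivlMr //; lra.
Qed.

Lemma inO0 n t : rval t = 0 -> ~ inO n t.
Proof. by move=> E [+ _]; have := e_gt0 n; rewrite E => *; lra. Qed.

Lemma cont_fam a : cont1 (T := T) (fam a).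
Proof.
move=> V t tV; have t0 : 0 <= rval t by exact: rval_ge0.
case: (pselect (exists n, inO n t)) => [[n nt]|tO].
  have [h1 h2] := nt.
  have [||d [d0 d1 d2]] := @min_ex _ _ _ (rval t - ap e n) (2 * ap e n - rval t); try lra.
  have sO s : close (rval s) (rval t) d -> inO n s by move=> [? ?]; split; lra.
  case: (pselect (bit a n)) => an.
    rewrite (fam_in an nt) in tV; have [c [c0 Hc]] := cont_piece tV.
    have [b [b0 bc bd]] := min_ex c0 d0.
    exists b; split=> // s cs; rewrite (fam_in an (sO _ (close_le cs bd))).
    exact/Hc/(close_le cs bc).
  have out s : inO n s -> fam a s = x.
    by move=> ns; apply: fam_out => m am ms; apply: an; rewrite (inO_uniq ns ms).
  by exists d; split=> // s /sO /out ->; rewrite -(out _ nt).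
have tx : fam a t = x by apply: fam_out => n _ nt; apply: tO; exists n.
rewrite tx in tV.
case: (eqVneq (rval t) 0) => rt.
  (* Within [ap e n] of 0 only intervals of index m with n ≼ m are met, and their loops stay in
     V. *)
  have [n Hn] := f_lim tV; exists (ap e n); split; first exact: e_gt0.
  move=> s [cs _]; case: (famP a s) => [[m [am [[ms _] ->]]]|[_ ->] //].
  apply: Hn; case: (leo_or_lto n m) => // /(halving_lt e_halving).
  by have := e_gt0 n => *; lra.
have rt0 : 0 < rval t by rewrite lt_neqAle eq_sym rt.
(* If t is outside ]e, 2e[ and s, within t/10 of t, is inside, then s < 11e/10 or s > 9e/5. By
   [piece_edge], whose bounds 6e/5 and 9e/5 lie outside [5e/4, 7e/4], the piece is at [x] there. *)
exists (rval t / 10); split=> [|s [c1 c2]]; first by lra.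
case: (famP a s) => [[m [am [[ms1 ms2] ->]]]|[_ ->] //].
rewrite piece_edge //; case: (lerP (rval t) (ap e m)) => h1; first by left; lra.
case: (lerP (2 * ap e m) (rval t)) => h2; first by right; lra.
by case: tO; exists m.
Qed.

Lemma famF_loop a : Loop (famF a).
Proof.
split; first by rewrite (funext (famFE a)); exact: cont_fam.
rewrite !famFE; split; apply: fam_out => n _; first by apply: inO0; exact: rval0.
by move=> [_]; rewrite rval1; have [_ h _] := e_halving n => *; lra.
Qed.

(** The two loops differ only on the interval of n, where the first runs through f_n and the second
    rests, so [nullhomotopic_of_paste] applies. *)
Lemma famF_flip a b n k : bit a n -> ~ bit b n ->
  (forall m, m <> n -> (bit a m <-> bit b m)) -> (forall t, ap k t = x) ->
  Hom (famF a) (famF b) -> Hom (ap f n) k.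
Proof.
move=> an bn ab kx; have [? ? _] := e_halving n.
apply: (nullhomotopic_of_paste (e := ap e n)) => //; first exact: famF_loop.
  move=> t h1 h2; have nt : inO n t by [].
  rewrite !famFE (fam_in an nt); split=> //; apply: fam_out => m bm mt.
  by apply: bn; rewrite (inO_uniq nt mt).
move=> t Ht; rewrite !famFE.
have nt : ~ inO n t by move=> [? ?]; case: Ht; lra.
have mn m : inO m t -> m <> n by move=> mt E; apply: nt; rewrite -E.
case: (famP a t) => [[m [am [mt ->]]]|[H ->]].
  by rewrite (fam_in _ mt) //; apply/ab => //; exact: mn.
by rewrite fam_out // => m bm mt; apply: H; exists m; split=> //; apply/ab => //; exact: mn.
Qed.

End Family.

(** * Meager sets *)

Section Increasing.
Context {M : structure} {zf : ZF M} {S : standard_sets M}.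
Variable b : Fn Nn Nn.
Hypothesis b_incr : forall k, ap b k ≺ ap b (succN k).

Lemma incr_le k m : k ≼ m -> ap b k ≼ ap b m.
Proof.
move: k m; apply: mono_leo; [by def | by move=> k; exact: leo_refl |].
by move=> k m H; apply: (leo_trans H); exact: ltoW.
Qed.

Lemma incr_lt k m : k ≺ m -> ap b k ≺ ap b m.
Proof. by move=> /succ_leo /incr_le; apply: lto_leo_trans. Qed.

Lemma incr_lt_rev k m : ap b k ≺ ap b m -> k ≺ m.
Proof.
move=> H; case: (leo_or_lto m k) => // /incr_le H'.
by case: (lto_leo_false H H').
Qed.

Lemma incr_inj k m : ap b k = ap b m -> k = m.
Proof.
move=> E; case: (lto_total k m) => [/incr_lt|[//|/incr_lt]]; rewrite E => H;
by case: (lto_irr H).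
Qed.

Lemma incr_ge k : k ≼ ap b k.
Proof.
move: k; apply: indN; [by def | exact: le0N |].
by move=> k H; apply: succ_leo; exact: (leo_lto_trans H).
Qed.

End Increasing.

Section Doubling.
Context {M : structure} {zf : ZF M} {S : standard_sets M}.

(** Substitute for n -> 2n with an arbitrary start. A code of pairs only requires the positions d(n)
    and d(n) + 1 to be distinct, not to exhaust omega. *)
Definition skipping (d : Nn -> Nn) := forall n, d (succN n) = succN (succN (d n)).

Lemma skipping_ex : DC S -> exists d : Fn Nn Nn, skipping (ap d).
Proof.
move=> dc; apply: (dependent_choice (R := fun n m => m = succN (succN n))) => //.
- exact: zeroN.
- by def.
- by move=> n; eexists.
Qed.

Variable d : Fn Nn Nn.
Hypothesis dS : skipping (ap d).

Lemma skip_incr n : ap d n ≺ ap d (succN n).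
Proof. by rewrite dS; apply: (lto_trans (lto_succ _)); exact: lto_succ. Qed.

Lemma skip_lt n m : n ≺ m -> succN (ap d n) ≺ ap d m.
Proof.
move=> /succ_leo /(incr_le skip_incr); rewrite dS.
exact: (lto_leo_trans (lto_succ _)).
Qed.

Lemma skip_succ n m : ap d n <> succN (ap d m).
Proof.
move=> E; case: (lto_total n m) => [/(incr_lt skip_incr)|[nm|/skip_lt]].
- by rewrite E => H; apply: (@lto_irr _ _ _ (ap d m)); apply: (lto_trans (lto_succ _) H).
- by apply: (@lto_irr _ _ _ (ap d n)); rewrite {2}E nm; exact: lto_succ.
- by rewrite E => H; apply: (lto_irr H).
Qed.

End Doubling.

Section Meager.
Context {M : structure} {zf : ZF M} {S : standard_sets M}.

Definition agreeon (k l : Nn) (a b : Can) :=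
  forall j, k ≼ j -> j ≺ l -> (bit b j <-> bit a j).

Lemma upd_ex (a : Can) (k : Nn) (p : Prop) : exists b : Can,
  (bit b k <-> p) /\ forall j, j <> k -> (bit b j <-> bit a j).
Proof.
have dP : definable (fun j => (j = k /\ p) \/ (j <> k /\ bit a j)) by def.
exists (mkCan dP); split=> [|j jk]; rewrite mkCanE.
  by split=> [[[]//|[]//]|?]; left.
by split=> [[[]//|[]//]|?]; right.
Qed.

(** Otherwise every cylinder inside the cylinder of [a] of length [n] meets N, and the latter is a
    nonempty open set in the closure of N. *)
Lemma nwd_cyl (N : M) : nowhere_dense (cantor S) (cantor_top S) N ->
  forall (a : Can) n, exists b m, n ≼ m /\ agree n a b /\
    forall c, agree m b c -> ~ emb c ∈ N.
Proof.
move=> [_ H] a n.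
have [|U [UC HU]] := subset_car (P := fun b : Can => agree n a b); first by def.
have UT : U ∈ cantor_top S.
  apply/cantor_open; split=> // b /HU ab; exists n => c bc; apply/HU => k kn.
  by rewrite (bc k kn) (ab k kn).
apply: contrapT => nH; apply: H; exists U; split=> //; split.
  by exists (emb a); apply/HU.
move=> z zU; have /El_carP [b E] := UC _ zU; subst z; split; first exact: valP.
move=> V VT bV; apply: contrapT => nV; apply: nH.
have /cantor_open [_ HV] := VT; have [m0 Hm0] := HV b bV.
have [m [nm m0m]] := maxN_ex n m0; exists b, m; split=> //; split; first exact/HU.
move=> c bc cN; apply: nV; exists (emb c); split=> //; apply: Hm0 => k km.
by apply: bc; apply: (lto_leo_trans km).
Qed.

(** The block has to avoid N whatever digits precede position k. Induction on k frees one digit at a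
    time: the block is extended first for the points with digit 0 at the freed position, then
    further for those with digit 1, and the second extension keeps the first. *)
Lemma avoid_one (N : M) : nowhere_dense (cantor S) (cantor_top S) N ->
  forall k (z0 : Can) l0, k ≼ l0 -> exists (z : Can) l, l0 ≼ l /\
    agreeon k l0 z0 z /\ forall c, agreeon k l z c -> ~ emb c ∈ N.
Proof.
move=> nwd; apply: indN; first by rewrite /agreeon; def.
  move=> z0 l0 _; have [b [m [lm [ag Hb]]]] := nwd_cyl nwd z0 l0.
  exists b, m; split=> //; split=> [j _|c Hc]; first exact: ag.
  by apply: Hb => j; apply: Hc; exact: le0N.
move=> k IH z0 l0 kl0; have kl0' : k ≺ l0 by apply: (lto_leo_trans (lto_succ k)).
have [z0a [za0 zaE]] := upd_ex z0 k False.
have [z1 [l1 [l01 [ag1 av1]]]] := IH z0a l0 (ltoW kl0').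
have kl1 : k ≺ l1 by apply: (lto_leo_trans kl0').
have [z1a [z1a0 z1aE]] := upd_ex z1 k True.
have [z2 [l2 [l12 [ag2 av2]]]] := IH z1a l1 (ltoW kl1).
have neq j : succN k ≼ j -> j <> k.
  by move=> kj E; apply: (@lto_irr _ _ _ j); rewrite {1}E;
    apply: (lto_leo_trans (lto_succ k)).
have kle j : succN k ≼ j -> k ≼ j.
  by move=> kj; apply: ltoW; apply: (lto_leo_trans (lto_succ k)).
have z21 j : succN k ≼ j -> j ≺ l1 -> (bit z2 j <-> bit z1 j).
  by move=> kj jl; rewrite (ag2 j (kle _ kj) jl) (z1aE j (neq _ kj)).
exists z2, l2; split; first exact: (leo_trans l01).
split=> [j kj jl|c Hc].
  rewrite z21 //; last exact: (lto_leo_trans jl).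
  by rewrite (ag1 j (kle _ kj) jl) (zaE j (neq _ kj)).
case: (pselect (bit c k)) => ck.
  apply: av2 => j kj jl; case/leoE: kj => [/succ_leo kj|<-]; first exact: Hc.
  by rewrite (ag2 k (leo_refl _) kl1) z1a0.
apply: av1 => j kj jl; case/leoE: kj => [/succ_leo kj|<-].
  by rewrite Hc ?z21 //; exact: (lto_leo_trans jl).
by rewrite (ag1 k (leo_refl _) kl0') za0.
Qed.

Variables (F : M) (idx : El F -> Nn).
Hypothesis didx : dfun idx.
Hypothesis idx_inj : forall N N', idx N = idx N' -> N = N'.
Hypothesis F_nwd : forall N, N ∈ F -> nowhere_dense (cantor S) (cantor_top S) N.

(** The members of index below i are avoided one after another, each time by lengthening the
    block. *)
Lemma avoid_many i : forall k (z0 : Can) l0, k ≼ l0 ->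
  exists (z : Can) l, l0 ≼ l /\ agreeon k l0 z0 z /\
    forall c, agreeon k l z c -> forall N, idx N ≺ i -> ~ emb c ∈ emb N.
Proof.
move: i; apply: indN; first by rewrite /agreeon; def.
  move=> k z0 l0 _; exists z0, l0; split; first exact: leo_refl.
  by split=> // c _ N /ltoN0.
move=> i IH k z0 l0 kl0; have [z1 [l1 [l01 [ag1 av1]]]] := IH k z0 l0 kl0.
case: (pselect (exists N, idx N = i)) => [[N Ni]|H]; last first.
  exists z1, l1; split=> //; split=> // c /av1 Hc N /leoE [|Ni]; first exact: Hc.
  by case: H; exists N.
have [z2 [l2 [l12 [ag2 av2]]]] :=
  avoid_one (F_nwd (valP N)) z1 (leo_trans kl0 l01).
exists z2, l2; split; first exact: (leo_trans l01).
split=> [j kj jl|c Hc N' /leoE [N'i|N'i]].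
- by rewrite ag2 ?ag1 //; exact: (lto_leo_trans jl).
- apply: av1 N'i => j kj jl; rewrite Hc ?ag2 //; exact: (lto_leo_trans jl).
- by rewrite (idx_inj (etrans N'i (esym Ni))); exact: av2.
Qed.

Variable d : Fn Nn Nn.
Hypothesis dS : skipping (ap d).

(* Every meager set misses all points that agree with some z on infinitely many
   blocks of some partition of omega into intervals. *)
Lemma meager_blocks : DC S -> exists (b : Fn Nn Nn) (z : Can),
  (forall k, ap b k ≺ ap b (succN k)) /\
  forall k c, agreeon (ap d (ap b k)) (ap d (ap b (succN k))) z c ->
    forall N, idx N ≺ k -> ~ emb c ∈ emb N.
Proof.
move=> dc.
(* A state (n, z) has fixed the digits of z below d(n). Block boundaries are values of [d], so that
   no pair of positions d(m), d(m) + 1 is cut. *)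
pose (R := fun p q : Nn * Can => p.1 ≺ q.1 /\ agree (ap d p.1) p.2 q.2 /\
  forall c, agreeon (ap d p.1) (ap d q.1) q.2 c ->
    forall N, idx N ≺ p.1 -> ~ emb c ∈ emb N).
have [|||s Hs] := dependent_choice (R := R) dc.
- split; [exact: zeroN | exact: (mkCan (def_cst False))].
- by rewrite /R /agreeon; def.
- move=> [n z0]; have [z1 [l [_ [_ av]]]] := avoid_many n z0 (leo_refl (ap d n)).
  have dP : definable (fun j => (j ≺ ap d n /\ bit z0 j) \/ (~ j ≺ ap d n /\ bit z1 j)).
    by def.
  have [m [nm lm]] := maxN_ex n l.
  have lm' : l ≺ ap d (succN m).
    apply: (leo_lto_trans lm); apply: (lto_leo_trans (lto_succ m)).
    exact: (incr_ge (skip_incr dS)).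
  exists (succN m, mkCan dP); split; first exact: (leo_lto_trans nm (lto_succ m)).
  split=> /= [j jn|c Hc N].
    by rewrite mkCanE; split=> [[[]//|[]//]|?]; left.
  apply: av => j nj jl; rewrite Hc //; last exact: (lto_trans jl).
  rewrite mkCanE; split=> [[[H _]|[] //]|H]; first by case: (leo_lto_false nj H).
  by right; split=> // H'; apply: (leo_lto_false nj H').
have ds1 : dfun (fun k => (ap s k).1) by def.
have coh : forall k m, k ≼ m -> agree (ap d (ap s k).1) (ap s k).2 (ap s m).2 /\
    (ap s k).1 ≼ (ap s m).1.
  apply: mono_leo; first by def.
    by move=> k; split=> //; exact: leo_refl.
  move=> k m [H1 H2]; have [H3 [H4 _]] := Hs m; split; last exact: (leo_trans H2 (ltoW H3)).
  move=> j jk; rewrite (H4 j); first exact: H1.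
  by apply: (lto_leo_trans jk); exact: (incr_le (skip_incr dS)).
(* The limit of the states: digit j is read off any state that has already fixed it. *)
have dz : definable (fun j => exists k, j ≺ ap d (ap s k).1 /\ bit (ap s k).2 j) by def.
have zE k j : j ≺ ap d (ap s k).1 -> (bit (mkCan dz) j <-> bit (ap s k).2 j).
  move=> jk; rewrite mkCanE; split=> [[k' [jk' bk']]|]; last by exists k.
  have [m [km k'm]] := maxN_ex k k'.
  by apply/((coh _ _ km).1 j jk)/((coh _ _ k'm).1 j jk').
have k_le k : k ≼ (ap s k).1.
  move: k; apply: indN; [by def | exact: le0N |] => k H.
  by apply: succ_leo; apply: (leo_lto_trans H); have [] := Hs k.
exists (lam ds1), (mkCan dz); split=> [k|k c]; first by rewrite !lamE; have [] := Hs k.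
rewrite !lamE => Hc N Nk; have [_ [_ Ha]] := Hs k; apply: Ha.
  by move=> j kj jl; rewrite Hc // (zE (succN k)).
exact: (lto_leo_trans Nk (k_le k)).
Qed.

End Meager.

(** * A sequence taking every value infinitely often *)

Section InfiniteFibers.
Context {M : structure} {zf : ZF M} {S : standard_sets M}.

Lemma zero_or_succ (n : Nn) : n = zeroN \/ exists k, n = succN k.
Proof.
move: n; apply: indN; [by def | by left |].
by move=> n _; right; exists n.
Qed.

(* The counter i descends to 0 and then restarts from j + 1. *)
Lemma infinite_fibers : DC S ->
  exists h : Fn Nn Nn, forall p n, exists m, n ≼ m /\ ap h m = p.
Proof.
move=> dc.
pose (R := fun s t : Nn * Nn => (exists k, s.1 = succN k /\ t = (k, s.2)) \/
  (s.1 = zeroN /\ t = (succN s.2, succN s.2))).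
have [|||s Hs] := dependent_choice (R := R) dc.
- by split; exact: zeroN.
- by rewrite /R; def.
- move=> [i j]; case: (zero_or_succ i) => [->|[k ->]].
    by exists (succN j, succN j); right.
  by exists (k, j); left; exists k.
have dh : dfun (fun n => (ap s n).1) by def.
have step n k : (ap s n).1 = succN k -> ap s (succN n) = (k, (ap s n).2).
  move=> E; case: (Hs n) => [[k' [+ ->]]|[+ _]]; rewrite E.
    by move/succ_inj => ->.
  by move=> E'; case: (@ltoN0 _ _ k); rewrite -E'; exact: lto_succ.
have restart n : (ap s n).1 = zeroN ->
    ap s (succN n) = (succN (ap s n).2, succN (ap s n).2).
  move=> E; case: (Hs n) => [[k [+ _]]|[_ //]]; rewrite E => E'.
  by case: (@ltoN0 _ _ k); rewrite E'; exact: lto_succ.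
have down : forall i n, (ap s n).1 = i -> exists m, n ≼ m /\
    ((ap s m).1 = zeroN /\ (ap s m).2 = (ap s n).2).
  apply: indN; first by def.
    by move=> n E; exists n; split; first exact: leo_refl.
  move=> i IH n /step E; have [|m [nm [m0 mE]]] := IH (succN n); first by rewrite E.
  exists m; split; first exact: (leo_trans (ltoW (lto_succ n))).
  by rewrite mE E.
have hit : forall i n, (ap s n).1 = i -> forall p, p ≼ i ->
    exists m, n ≼ m /\ (ap s m).1 = p.
  apply: indN; first by def.
    move=> n E p /leoE [/ltoN0 //|->]; exists n; split=> //; exact: leo_refl.
  move=> i IH n E p /leoE [pi|->]; last by exists n; split=> //; exact: leo_refl.
  have [m [nm mE]] := IH (succN n) (congr1 fst (step n i E)) p pi.
  by exists m; split=> //; exact: (leo_trans (ltoW (lto_succ n))).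
(* Every restart raises the bound, so some later descent starts at or above the desired value and
   passes through it. *)
have large : forall q n, exists m, n ≼ m /\ ((ap s m).1 = zeroN /\ q ≼ (ap s m).2).
  apply: indN; first by def.
    move=> n; have [m [nm [m0 _]]] := down _ n erefl.
    by exists m; split=> //; split=> //; exact: le0N.
  move=> q IH n; have [m [nm [m0 qm]]] := IH n.
  have [m' [mm' [m0' E]]] := down _ (succN m) erefl.
  exists m'; split; last by split=> //; rewrite E (restart m m0); exact: succ_leo.
  exact: (leo_trans nm (leo_trans (ltoW (lto_succ m)) mm')).
exists (lam dh) => p n; have [m [nm [m0 pm]]] := large p n.
have [|m' [mm' E]] := hit _ (succN m) erefl p.
  by rewrite (restart m m0); exact: ltoW.
exists m'; rewrite lamE; split=> //.
exact: (leo_trans nm (leo_trans (ltoW (lto_succ m)) mm')).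
Qed.

End InfiniteFibers.

(** * Pairwise inequivalent points from the Baire property *)

Section Perfect.
Context {M : structure} {zf : ZF M} {S : standard_sets M}.
Variable E : Can -> Can -> Prop.
Hypothesis dE : definable (fun p : Can * Can => E p.1 p.2).
Hypothesis E_sym : forall a b, E a b -> E b a.
Hypothesis E_trans : forall b a c, E a b -> E b c -> E a c.
Hypothesis E_flip : forall a b n, ~ (bit a n <-> bit b n) ->
  (forall m, m <> n -> (bit a m <-> bit b m)) -> ~ E a b.
Hypothesis dc : DC S.
Hypothesis baire : all_baire_property S.

Lemma perfect_family : exists phi : Can -> Can, dfun phi /\
  forall a b, E (phi a) (phi b) -> a = b.
Proof.
have [d dS] := skipping_ex dc; have [h Hh] := infinite_fibers dc.
have d_incr := skip_incr dS.
pose (P := fun c : Can => exists a b, (forall n, bit a n <-> bit c (ap d n)) /\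
  ((forall n, bit b n <-> bit c (succN (ap d n))) /\ E a b)).
have [|Y [YC HY]] := subset_car (P := P); first by rewrite /P; def.
have [U [D [UT [DE [F [cF [F_nwd FD]]]]]]] := baire YC.
have [idx idx_inj] := countable_index cF.
have didx : dfun (ap idx) by def.
have [b [z [b_incr Hb]]] := meager_blocks didx idx_inj F_nwd dS dc.
pose (block := fun (k : Nn) (c : Can) => agreeon (ap d (ap b k)) (ap d (ap b (succN k))) z c).
(* Block k avoids the members of index below k, so a point matching [z] on arbitrarily late blocks
   escapes every member of F. *)
have blockD (c : Can) : (forall n, exists k, n ≼ k /\ block k c) -> ~ emb c ∈ D.
  move=> Hc /FD [N [NF cN]]; have [k [Nk /Hb Hk]] := Hc (succN (ap idx (MkEl N NF))).
  by apply: (Hk (MkEl N NF)) => //; exact: (lto_leo_trans (lto_succ _) Nk).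
(* Otherwise let [c1] follow [c] below n and [z] from n on, and let [c2] differ from it only at
   position d(n), which is at least n. Both lie in U and match [z] on all late blocks, so both code
   related pairs, and these have the same second component. *)
have U0 (c : Can) : ~ emb c ∈ U.
  move=> cU; have /cantor_open [_ /(_ c cU) [n Hn]] := UT.
  have dc1 : definable (fun i => (i ≺ n /\ bit c i) \/ (~ i ≺ n /\ bit z i)) by def.
  pose (c1 := mkCan dc1).
  have [c2 [c2n c2E]] := upd_ex c1 (ap d n) (~ bit c1 (ap d n)).
  have far k i : succN n ≼ k -> ap d (ap b k) ≼ i -> ap d n ≺ i.
    move=> nk; apply: lto_leo_trans; apply: (incr_lt d_incr).
    by apply: (lto_leo_trans (lto_succ n)); apply: (leo_trans nk); exact: incr_ge.
  have nd i : ap d n ≺ i -> ~ i ≺ n.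
    move=> ni /(lto_trans ni) H; apply: (leo_lto_false _ H).
    exact: (incr_ge d_incr).
  have inY (c' : Can) : agree n c c' -> (forall k, succN n ≼ k -> block k c') -> P c'.
    move=> /Hn c'U Hc'; apply/HY; apply: contrapT => nY.
    apply: (@blockD c'); last by apply/DE; right.
    move=> m; have [k [mk nk]] := maxN_ex m (succN n).
    by exists k; split=> //; exact: Hc'.
  have [||a1 [b1 [a1E [b1E E1]]]] := inY c1.
  - move=> i ni; rewrite mkCanE; split=> [[[]//|[]//]|?]; by left.
  - move=> k nk i ki _; rewrite mkCanE; have ni := nd _ (far _ _ nk ki).
    by split=> [[[]//|[]//]|?]; right.
  have c21 i : i <> ap d n -> (bit c2 i <-> bit c1 i) by exact: c2E.
  have [||a2 [b2 [a2E [b2E E2]]]] := inY c2.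
  - move=> i ni; rewrite c21; last first.
      move=> Ei; rewrite Ei in ni; apply: (leo_lto_false _ ni).
      exact: (incr_ge d_incr).
    rewrite mkCanE; split=> [[[]//|[]//]|?]; by left.
  - move=> k nk i ki _; have ni := far _ _ nk ki.
    rewrite c21; last by move=> Ei; rewrite Ei in ni; exact: (lto_irr ni).
    have ni' := nd _ ni; by rewrite mkCanE; split=> [[[]//|[]//]|?]; right.
  have b12 : b1 = b2.
    apply: Can_ext => i; rewrite b1E b2E c21 // => Ei.
    exact: (skip_succ dS (esym Ei)).
  subst b2; apply: (E_flip (n := n)) (E_trans E1 (E_sym E2)).
    by rewrite a1E a2E c2n => -[? ?]; tauto.
  move=> m mn; rewrite a1E a2E c21 // => Em; apply: mn; exact: (incr_inj d_incr Em).
pose (Q := fun (a : Can) n => exists k, (ap b k ≼ n /\ n ≺ ap b (succN k)) /\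
  ((bit a (ap h k) /\ bit z (ap d n)) \/
   (~ bit a (ap h k) /\ bit z (succN (ap d n))))).
have dQ a : definable (Q a) by rewrite /Q; def.
pose (phi := fun a => mkCan (dQ a)).
have phiE a n : bit (phi a) n <-> Q a n by exact: mkCanE.
have Qin a k n : ap b k ≼ n -> n ≺ ap b (succN k) ->
    (bit (phi a) n <-> (bit a (ap h k) /\ bit z (ap d n)) \/
      (~ bit a (ap h k) /\ bit z (succN (ap d n)))).
  move=> kn nk; rewrite phiE; split=> [[k' [[k'n nk'] Hk']]|]; last by exists k.
  suff -> : k = k' by [].
  have aux i i' : i ≺ i' -> ap b i' ≼ n -> n ≺ ap b (succN i) -> False.
    move=> /succ_leo ii' i'n ni; apply: (leo_lto_false _ ni).
    by apply: (leo_trans _ i'n); exact: incr_le.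
  by case: (lto_total k k') => [/aux /(_ k'n nk)|[//|/aux /(_ kn nk')]].
have phi_sep a a' p : bit a p -> ~ bit a' p -> ~ E (phi a) (phi a').
  move=> ap_ a'p EE.
  (* The code of the pair, completed by [z] at the positions that the coding leaves free so that
     whole blocks can match. *)
  have dg : definable (fun i => (exists n, i = ap d n /\ bit (phi a) n) \/
      (exists n, i = succN (ap d n) /\ bit (phi a') n) \/
      (~ (exists n, i = ap d n \/ i = succN (ap d n)) /\ bit z i)) by def.
  pose (g := mkCan dg).
  have g_even n : bit g (ap d n) <-> bit (phi a) n.
    rewrite mkCanE; split=> [|H]; last by left; exists n.
    case=> [[m [/(incr_inj d_incr) -> //]]|[[m [/(skip_succ dS) //]]|[[]]]].
    by exists n; left.
  have g_odd n : bit g (succN (ap d n)) <-> bit (phi a') n.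
    rewrite mkCanE; split=> [|H]; last by right; left; exists n.
    case=> [[m [/esym/(skip_succ dS) //]]|[[m [/succ_inj/(incr_inj d_incr) -> //]]|[[]]]].
    by exists n; right.
  have gY : P g.
    exists (phi a), (phi a'); split=> [n|]; first by rewrite g_even.
    by split=> // n; rewrite g_odd.
  (* As U is empty, a code of a related pair lies in the meager set D; but [g] matches [z] on each
     of the infinitely many blocks k with h(k) = p. *)
  apply: (@blockD g); last by apply/DE; left; split; [exact/HY | exact: U0].
  move=> n; have [k [nk hk]] := Hh p n; exists k; split=> // i ki ik.
  case: (pselect (exists n, i = ap d n)) => [[m Em]|Ne].
    rewrite Em in ki ik *; rewrite g_even (Qin a k) ?hk.
    - by split=> [[[]|[]] //|?]; left.
    - by case: (leo_or_lto (ap b k) m) => // /(incr_lt d_incr) /(leo_lto_false ki).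
    - exact: (incr_lt_rev d_incr ik).
  case: (pselect (exists n, i = succN (ap d n))) => [[m Em]|No].
    rewrite Em in ki ik *; rewrite g_odd (Qin a' k) ?hk.
    - by split=> [[[]|[]] //|?]; right.
    - by case: (leo_or_lto (ap b k) m) => // /(skip_lt dS) /(leo_lto_false ki).
    - exact: (incr_lt_rev d_incr (lto_trans (lto_succ _) ik)).
  rewrite mkCanE; split=> [[[m [Em _]]|[[m [Em _]]|[_ //]]]|H].
  - by case: Ne; exists m.
  - by case: No; exists m.
  - by right; right; split=> // -[m [Em|Em]]; [case: Ne|case: No]; exists m.
exists phi; split.
  apply: (dfun_char (Q := fun a c => forall n, bit c n <-> Q a n)).
    by rewrite /Q; def.
  move=> a c; split=> [-> n|H]; first exact: phiE.
  by apply: Can_ext => n; rewrite H phiE.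
move=> a a' EE; apply: Can_ext => p; split=> H; apply: contrapT => nH.
  exact: (phi_sep a a' p H nH EE).
exact: (phi_sep a' a p H nH (E_sym EE)).
Qed.

End Perfect.

(** * The fundamental group *)

Section Essential.
Context {M : structure} {zf : ZF M} {S : standard_sets M} {X T : M} {x : El X}.

Local Notation Loop := (based_loop (T := T) (x := x)).
Local Notation Hom := (rel_homotopic (T := T) (x := x)).

Lemma def_Loop : definable Loop.
Proof. by rewrite /based_loop /cont1; def. Qed.
Lemma def_Hom : definable (fun p : Fn Itv (El X) * Fn Itv (El X) => Hom p.1 p.2).
Proof. by rewrite /rel_homotopic /cont2; def. Qed.
Local Hint Resolve def_Loop def_Hom : def.

Lemma is_classE (c : M) (f : Fn Itv (El X)) : is_class S X T (val x) c (val f) <->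
  c ⊆ car (Fn Itv (El X)) /\
  forall g : Fn Itv (El X), emb g ∈ c <-> Loop g /\ Hom f g.
Proof.
split=> [H|[cF H] g].
  split=> [g /H [/loop_Fn [G [<- _]] _]|g]; first exact: valP.
  rewrite (H (val g)) homotopic_Fn; split=> -[Lg Hg]; split=> //.
    by have /loop_Fn [G [/val_inj <-]] := Lg.
  by apply/loop_Fn; exists g.
split=> [gc|[/loop_Fn [G [E LG]]]].
  have /El_carP [G E] := cF _ gc; subst g; have [LG HG] := iffLR (H G) gc.
  by split; [apply/loop_Fn; exists G | apply/homotopic_Fn].
by subst g => /homotopic_Fn HG; apply/H.
Qed.

Definition nonnull (f : Fn Itv (El X)) :=
  forall k, (forall t, ap k t = x) -> ~ Hom f k.

(** A homotopy from the loop to a constant one would, by symmetry and transitivity, make the two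
    classes equal as sets. *)
Lemma essentialE f : essential S X T (val x) f ->
  exists F : Fn Itv (El X), val F = f /\ Loop F /\ nonnull F.
Proof.
move=> [/loop_Fn [F [<- LF]] [c [d [k [Hc [[kF kx] [Hd cd]]]]]]].
exists F; split=> //; split=> // k' k'x HFk; apply: cd.
have kF' : is_fun k (car Itv) (car (El X)) by [].
have [K KE] := iffLR (FnP k) kF'.
have EK : K = k'.
  apply: Fn_ext => t; rewrite k'x; apply/rel_ap; rewrite KE.
  by apply: kx; exact: valP.
subst k k'; have [cA Hc'] := iffLR (is_classE _ _) Hc.
have [dA Hd'] := iffLR (is_classE _ _) Hd.
apply: (sub_ext (A := Fn Itv (El X))) => // g; rewrite Hc' Hd'.
split=> -[Lg Hg]; split=> //; first exact: (Hom_trans (Hom_sym HFk) Hg).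
exact: (Hom_trans HFk Hg).
Qed.

(** The countable base need not be decreasing and its members need not be open. Each loop is
    therefore taken in an open set that lies inside all members of index below the current stage. *)
Lemma essential_sequence : DC S -> topology X T -> first_countable_at S X T (val x) ->
  (forall N, neighborhood X T (val x) N ->
     exists f, essential S X T (val x) f /\
       (forall t y, t ∈ itv S -> rel f t y -> y ∈ N)) ->
  exists f : Fn Nn (Fn Itv (El X)),
    (forall n, Loop (ap f n) /\ nonnull (ap f n)) /\
    forall V : El T, emb x ∈ emb V ->
      exists n, forall m, n ≼ m -> forall t, emb (ap (ap f m) t) ∈ emb V.
Proof.
move=> dc topT [B [cB [Bn Bbase]]] ess.
have [idx idx_inj] := countable_index cB.
have [TX [_ [XT _]]] := topT.
have nbhs_open (U : El T) : emb x ∈ emb U -> neighborhood X T (val x) (val U).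
  move=> xU; split; first exact: (TX _ (valP U)).
  by exists (val U); split; [exact: valP | split].
have base : forall i, exists U : El T, emb x ∈ emb U /\
    forall N, ap idx N ≺ i -> forall y : El X, emb y ∈ emb U -> emb y ∈ emb N.
  apply: indN; first by def.
    by exists (MkEl X XT); split=> [|N /ltoN0 //]; exact: valP.
  move=> i [U [xU HU]]; case: (pselect (exists N, ap idx N = i)) => [[N Ni]|Hi].
    have [_ [V [VT [xV VN]]]] := Bn _ (valP N).
    have [W HW] := inter_topology U (MkEl V VT) topT.
    exists W; split; first exact/HW.
    move=> N' /leoE [N'i|N'i] y /HW [yU yV]; first exact: HU yU.
    by rewrite (idx_inj _ _ (etrans N'i (esym Ni))); exact: VN.
  exists U; split=> // N /leoE [|Ni]; first exact: HU.
  by case: Hi; exists N.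
(* Dependent choice relates consecutive values without access to the index, so the state carries its
   own stage counter. Its start is unknown, and only k ≼ counter is used at index k. *)
pose (R := fun s t : Nn * Fn Itv (El X) => t.1 = succN s.1 /\
  ((Loop t.2 /\ nonnull t.2) /\
   forall N, ap idx N ≺ t.1 -> forall u, emb (ap t.2 u) ∈ emb N)).
have [|||s Hs] := dependent_choice (R := R) dc.
- by split; [exact: zeroN | exact: (lam (dfun_cst x))].
- by rewrite /R /nonnull; def.
- move=> [i f0]; have [U [xU HU]] := base (succN i).
  have nU : neighborhood X T (val x) (val U) by exact: nbhs_open.
  have [_ [/essentialE [F [<- LF]] Fr]] := ess _ nU.
  exists (succN i, F); split=> //; split=> // N Ni u; apply: (HU N Ni).
  by apply: (Fr (val u)); [exact: valP | exact/(rel_ap F)].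
(* The loop in the first state is unconstrained, hence the shift by one. *)
have df : dfun (fun n => (ap s (succN n)).2) by def.
exists (lam df); split=> [n|V xV].
  by rewrite lamE; have [_ [H _]] := Hs n.
have nV : neighborhood X T (val x) (val V) by exact: nbhs_open.
have [N [NB NV]] := Bbase _ nV.
exists (succN (ap idx (MkEl N NB))) => m Nm t; rewrite lamE; apply: NV.
have s_ge : forall k, k ≼ (ap s k).1.
  apply: indN; [by def | exact: le0N |] => k H.
  by have [-> _] := Hs k; exact: succ_lto.
have [_ [_ H]] := Hs m; apply: (H (MkEl N NB)).
apply: (lto_leo_trans (lto_succ _)); apply: (leo_trans Nm).
exact: (leo_trans (ltoW (lto_succ m)) (s_ge _)).
Qed.

(** The class of [g a] is determined by a definable condition, so sending [a] to it is a function of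
    [M]. If two classes coincide, reflexivity puts the second loop into the class of the first. *)
Lemma pi1_injection (g : Can -> Fn Itv (El X)) : dfun g -> (forall a, Loop (g a)) ->
  (forall a b, Hom (g a) (g b) -> a = b) ->
  exists P, is_pi1 S X T (val x) P /\ card_le (cantor S) P.
Proof.
move=> dg g_loop g_inj.
have is_classP (c : M) f : is_class S X T (val x) c (val f) <->
    exists C : El (power (car (Fn Itv (El X)))), val C = c /\
      forall h : Fn Itv (El X), emb h ∈ emb C <-> Loop h /\ Hom f h.
  rewrite is_classE; split=> [[cF H]|[C [<- H]]].
    have cp : c ∈ power (car (Fn Itv (El X))) by apply/powerP.
    by exists (MkEl c cp).
  by split=> //; apply/powerP; exact: valP.
have [|P [PF HP]] := subset_car (P := fun C : El (power (car (Fn Itv (El X)))) =>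
  exists f, Loop f /\ forall h : Fn Itv (El X), emb h ∈ emb C <-> Loop h /\ Hom f h).
  by def.
exists P; split=> [c|].
  split=> [cP|[_ [/loop_Fn [f [<- Lf]] /is_classP [C [<- HC]]]]]; last first.
    by apply/HP; exists f.
  have /El_carP [C CE] := PF _ cP; subst c.
  have /HP [f [Lf HC]] := cP; exists (val f).
  by split; [apply/loop_Fn; exists f | apply/is_classP; exists C].
have cls_ex a : exists C : El P,
    forall h : Fn Itv (El X), emb h ∈ emb C <-> Loop h /\ Hom (g a) h.
  have [|c [cF Hc]] := subset_car (P := fun h => Loop h /\ Hom (g a) h); first by def.
  have cp : c ∈ power (car (Fn Itv (El X))) by apply/powerP.
  have cP : c ∈ P by apply/(HP (MkEl c cp)); exists (g a).
  by exists (MkEl c cP).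
pose (cls := fun a => sval (cid (cls_ex a))).
have clsP a h : emb h ∈ emb (cls a) <-> Loop h /\ Hom (g a) h.
  exact: (svalP (cid (cls_ex a))).
have dcls : dfun cls.
  apply: (dfun_char (Q := fun a (C : El P) =>
    forall h : Fn Itv (El X), emb h ∈ emb C <-> Loop h /\ Hom (g a) h)).
    by def.
  move=> a C; split=> [-> h|H]; first exact: clsP.
  have sub (C' : El P) : emb C' ⊆ car (Fn Itv (El X)).
    by apply/powerP; apply: PF; exact: valP.
  apply: val_inj; apply: (sub_ext (A := Fn Itv (El X))); try exact: sub.
  by move=> h; rewrite H clsP.
exists (val (lam dcls)); split; first exact: (Fn_fun (lam dcls)).
have dom a c : rel (val (lam dcls)) a c -> exists a' : Can, val a' = a /\ val (cls a') = c.
  move=> ac; have /relE /(Fn_fun (lam dcls)).1 := ac.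
  move=> [_ [_ [/El_carP [a' <-] [/El_carP [c' <-] /is_opairE /opair_inj [? ?]]]]].
  subst a c; exists a'; split=> //.
  by move/(rel_ap (lam dcls)): ac; rewrite lamE => <-.
move=> a a' c /dom [b [<- <-]] /dom [b' [<- /val_inj E]].
congr val; apply: g_inj.
have : emb (g b') ∈ emb (cls b) by rewrite -E; apply/clsP; split=> //; exact: Hom_refl.
by move/clsP=> [].
Qed.

End Essential.

Theorem corollary2p10 :
  forall (M : structure) (S : standard_sets M),
    ZF M -> DC S -> all_baire_property S ->
    forall X T x : M,
      topology X T -> x ∈ X ->
      first_countable_at S X T x ->
      (forall N, neighborhood X T x N ->
         exists f, essential S X T x f /\
           (forall t y, t ∈ itv S -> rel f t y -> y ∈ N)) ->
      exists P, is_pi1 S X T x P /\ card_le (cantor S) P.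
Proof.
move=> M S zf dc baire X T x0 topT x0X fc ess.
pose (x := MkEl x0 x0X : El X).
have [f [f_ess f_lim]] := essential_sequence (x := x) dc topT fc ess.
have f_loop n := (f_ess n).1.
have [e He] := halving_ex dc.
pose (g := famF (x := x) f He).
have dg : dfun g by exact: dfun_famF.
have g_loop a : based_loop (T := T) (x := x) (g a) by exact: famF_loop.
pose (k := lam (dfun_cst (A := Itv) x)).
have kx t : ap k t = x by rewrite lamE.
have g_flip a b n : bit a n -> ~ bit b n ->
    (forall m, m <> n -> (bit a m <-> bit b m)) -> ~ rel_homotopic (T := T) (x := x) (g a) (g b).
  move=> an bn ab H; apply: ((f_ess n).2 k kx).
  exact: (famF_flip f_loop f_lim an bn ab kx H).
have [||||phi [dphi phi_inj]] := perfect_family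
  (E := fun a b => rel_homotopic (T := T) (x := x) (g a) (g b)) _ _ _ _ dc baire.
- by have dH := def_Hom (X := X) (T := T) (x := x); def.
- by move=> a b; exact: Hom_sym.
- by move=> b a c; exact: Hom_trans.
- move=> a b n abn ab; case: (pselect (bit a n)) => an.
    by apply: (g_flip _ _ n) => // bn; apply: abn.
  (* [g_flip] expects the digit 1 on the left, so here the homotopy is reversed. *)
  move=> /Hom_sym; apply: (g_flip _ _ n) => // [|m mn]; last by rewrite ab.
  by apply: contrapT => bn; apply: abn; split.
exact: (pi1_injection (x := x) (dfun_compose dphi dg)).
Qed.
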